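(* Let $n=p+q$, let $b$ be a non-degenerate symmetric bilinear form of signature $(p,q)$ on $\mathbb R^n$, let $1\le i\le n-1$, and for $0\le r\le p$, $0\le s\le q$, $r+s\le i$ let $\mathcal O_{(r,s)}\subset Gr(i,\mathbb R^n)$ be the set of $i$-dimensional subspaces on which $b$ restricts to a form of signature $(r,s)$. Then each of the orbits $\mathcal O_{(r,s)}$ is an embedded submanifold of $Gr(i,\mathbb R^n)$. Moreover, for each point $x\in\mathcal O_{(r,s)}$ there is an open neighborhood $U$ of $x$ in $Gr(i,\mathbb R^n)$ and a diffeomorphism $\varphi$ from $U$ onto an open neighborhood of $(U\cap\mathcal O_{(r,s)})\times\{0\}$ in $(U\cap\mathcal O_{(r,s)})\times S^2\mathbb R^{(i-r-s)*}$ such that $U\subset\bigcup_{r'\ge r,\,s'\ge s}\mathcal O_{(r',s')}$ and a point $y\in U$ lies in $\mathcal O_{(r',s')}$ if and only if the second component of $\varphi(y)$ has signature $(r'-r,s'-s)$.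
   Context: The sets $\mathcal O_{(r,s)}$ are the orbits under the action of $H=SO(p,q)$ (the special orthogonal group of $b$) on $Gr(i,\mathbb R^n)$. A symmetric bilinear form has signature $(r,s)$ if $r$ and $s$ are the maximal dimensions of subspaces on which it is positive, respectively negative, definite (degenerate forms allowed; the rank is $r+s$). $S^2\mathbb R^{\nu*}$ denotes the space of symmetric bilinear forms on $\mathbb R^\nu$. *)

(* Defs.v *)
From HB Require Import structures.
From mathcomp Require Import all_boot all_order all_algebra.
From mathcomp Require Import all_classical all_reals all_analysis.
Set Implicit Arguments.
Unset Strict Implicit.
Unset Printing Implicit Defensive.
Import Order.TTheory GRing.Theory Num.Theory.
Import numFieldNormedType.Exports.
Local Open Scope classical_set_scope.
Local Open Scope ring_scope.

(* For finite-dimensional V and open D this is the usual C^k: a function is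
   C^(k+1) on D iff it is differentiable on D and all its directional
   derivatives are C^k on D.  Only used with D open. *)
Fixpoint Ck_on (R : realType) (V W : normedModType R) (k : nat) (D : set V)
    (f : V -> W) : Prop :=
  match k with
  | 0 => forall x, D x -> {for x, continuous f}
  | k'.+1 => (forall x, D x -> differentiable f x) /\
             (forall v, Ck_on k' D ('D_v f : V -> W))
  end.

Definition smooth_on (R : realType) (V W : normedModType R) (D : set V)
    (f : V -> W) : Prop := forall k, Ck_on k D f.

(* A chart with values in R^d.  The values of [cmap c] outside [cdom c]
   are irrelevant: every definition below only looks at [cmap c] on [cdom c]. *)
Record chart (R : realType) (d : nat) (T : Type) :=
  Chart { cdom : set T ; cmap : T -> 'rV[R]_d }.

Definition atlas (R : realType) (d : nat) (T : Type) := set (chart R d T).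

(* The manifold topology: W is open iff it is open in each chart. *)
Definition mopen (R : realType) d T (A : atlas R d T) (W : set T) : Prop :=
  forall c, A c -> open (cmap c @` (cdom c `&` W)).

(* f \o c^-1 is smooth on the set c(W), for a chart c whose domain contains W
   (g is determined on c(W) by f). *)
Definition smooth_in_chart (R : realType) d e T (c : chart R d T) (W : set T)
    (f : T -> 'rV[R]_e) : Prop :=
  exists2 g : 'rV[R]_d -> 'rV[R]_e,
    smooth_on (cmap c @` W) g & forall x, W x -> f x = g (cmap c x).

Definition compatible (R : realType) d T (c c' : chart R d T) : Prop :=
  let W := cdom c `&` cdom c' in
  [/\ open (cmap c @` W), open (cmap c' @` W),
      smooth_in_chart c W (cmap c') & smooth_in_chart c' W (cmap c)].

(* The charts of the maximal atlas generated by A. *)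
Definition smooth_chart (R : realType) d T (A : atlas R d T)
    (c : chart R d T) : Prop :=
  [/\ {in cdom c &, injective (cmap c)}, open (cmap c @` cdom c)
    & forall c', A c' -> compatible c c'].

Definition smooth_map (R : realType) d e T T' (A : atlas R d T)
    (A' : atlas R e T') (D : set T) (f : T -> T') : Prop :=
  forall x, D x -> exists c c' W,
    [/\ A c, A' c' & mopen A W] /\
    [/\ W x, W `<=` D `&` cdom c, f @` W `<=` cdom c'
      & smooth_in_chart c W (cmap c' \o f)].

(* f restricts to a diffeomorphism from the open set U onto the open set V. *)
Definition diffeomorphism (R : realType) d e T T' (A : atlas R d T)
    (A' : atlas R e T') (U : set T) (V : set T') (f : T -> T') : Prop :=
  [/\ mopen A U, mopen A' V, set_bij U V f, smooth_map A A' U f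
    & exists2 g : T' -> T, {in U, cancel f g} & smooth_map A' A V g].

Definition slice (R : realType) (d k : nat) : set 'rV[R]_d :=
  [set y | forall j : 'I_d, (k <= j)%N -> y ord0 j = 0].

Definition slice_chart (R : realType) d T (A : atlas R d T) (S : set T)
    (k : nat) (c : chart R d T) : Prop :=
  smooth_chart A c /\
  cmap c @` (cdom c `&` S) = (cmap c @` cdom c) `&` @slice R d k.

Definition embedded_submanifold (R : realType) d T (A : atlas R d T)
    (S : set T) (k : nat) : Prop :=
  (k <= d)%N /\ forall x, S x -> exists2 c, slice_chart A S k c & cdom c x.

(* The manifold structure of an embedded submanifold S of dimension k: the
   slice charts, restricted to S and truncated to the first k coordinates. *)
Definition sub_chart (R : realType) d T (S : set T) (k : nat)
    (c : chart R d T) : chart R k (set_type S) :=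
  Chart [set x : set_type S | cdom c (set_val x)]
        (fun x => cmap c (set_val x) *m pid_mx k).

Definition sub_atlas (R : realType) d T (A : atlas R d T) (S : set T)
    (k : nat) : atlas R k (set_type S) :=
  [set sub_chart S k c | c in slice_chart A S k].
Arguments sub_atlas {R d T} A S k.

Definition prod_chart (R : realType) d e T T' (c : chart R d T)
    (c' : chart R e T') : chart R (d + e) (T * T') :=
  Chart (cdom c `*` cdom c') (fun z => row_mx (cmap c z.1) (cmap c' z.2)).

Definition prod_atlas (R : realType) d e T T' (A : atlas R d T)
    (A' : atlas R e T') : atlas R (d + e) (T * T') :=
  [set c | exists c1 c2, [/\ A c1, A' c2 & c = prod_chart c1 c2]].

(* The charts of a finite-dimensional vector space are its linear coordinate
   systems, one for each basis. *)
Definition vect_atlas (R : realType) (V : vectType R) :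
    atlas R (\dim {:V}) V :=
  [set c | exists2 B : (\dim {:V}).-tuple V, basis_of fullv B
    & c = Chart setT (fun v => \row_j coord B j v)].
Arguments vect_atlas {R} V.

Definition Gr (R : realType) (i n : nat) : Type :=
  {W : {vspace 'rV[R]_n} | \dim W == i}.

Definition rowspan (R : realType) m n (M : 'M[R]_(m, n)) : {vspace 'rV[R]_n} :=
  <<[seq row j M | j <- enum 'I_m]>>%VS.

(* The rows of e and f together form a basis of R^n, giving the decomposition
   R^n = E (+) F with E = rowspan e, F = rowspan f.  The chart is defined on the
   subspaces W transverse to F; such a W is the graph of a unique linear map
   E -> F, and its coordinates are the matrix of that map. *)
Definition Gr_chart (R : realType) i n (e : 'M[R]_(i, n))
    (f : 'M[R]_(n - i, n)) : chart R (i * (n - i)) (Gr R i n) :=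
  Chart [set W : Gr R i n | (val W :&: rowspan f)%VS = 0%VS]
        (fun W => mxvec (xget 0 [set X : 'M[R]_(i, n - i) |
                                   val W = rowspan (e + X *m f)])).

Definition Gr_atlas (R : realType) i n : atlas R (i * (n - i)) (Gr R i n) :=
  [set c | exists e f, row_full (col_mx e f) /\ c = Gr_chart e f].
Arguments Gr_atlas R i n : clear implicits.

(* S^2 R^m*: symmetric bilinear forms on R^m, given by their Gram matrices. *)
Definition sym_forms (R : realType) (m : nat) : vectType R :=
  subvs_of (fixedSpace (linfun (@trmx R m m))).

Definition bform (R : realType) m (b : sym_forms R m) (x y : 'rV[R]_m) : R :=
  (x *m vsval b *m y^T) ord0 ord0.

Definition posdef_on (R : realType) m (b : 'rV[R]_m -> 'rV[R]_m -> R)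
    (F : {vspace 'rV[R]_m}) : Prop :=
  forall x, x \in F -> x != 0 -> 0 < b x x.

Definition negdef_on (R : realType) m (b : 'rV[R]_m -> 'rV[R]_m -> R)
    (F : {vspace 'rV[R]_m}) : Prop :=
  forall x, x \in F -> x != 0 -> b x x < 0.

Definition max_dim (R : realType) m (P : {vspace 'rV[R]_m} -> Prop)
    (r : nat) : Prop :=
  (exists2 F, P F & \dim F = r) /\ (forall F, P F -> (\dim F <= r)%N).

(* The restriction of b to W has signature (r, s). *)
Definition signature_on (R : realType) m (b : 'rV[R]_m -> 'rV[R]_m -> R)
    (W : {vspace 'rV[R]_m}) (r s : nat) : Prop :=
  max_dim (fun F => (F <= W)%VS /\ posdef_on b F) r /\
  max_dim (fun F => (F <= W)%VS /\ negdef_on b F) s.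

Definition has_signature (R : realType) m (b : 'rV[R]_m -> 'rV[R]_m -> R)
    (r s : nat) : Prop := signature_on b fullv r s.

Definition orbit_rs (R : realType) i n (b : 'rV[R]_n -> 'rV[R]_n -> R)
    (r s : nat) : set (Gr R i n) :=
  [set W | signature_on b (val W) r s].
Arguments orbit_rs {R} i {n} b r s.

(* Main.v *)
From HB Require Import structures.
Require Import Defs.
From mathcomp Require Import all_boot all_order all_algebra.
From mathcomp Require Import all_classical all_reals all_analysis.
From mathcomp Require Import ring lra zify.
Set Implicit Arguments.
Unset Strict Implicit.
Unset Printing Implicit Defensive.
Import Order.TTheory GRing.Theory Num.Theory.
Import numFieldNormedType.Exports.
Local Open Scope classical_set_scope.
Local Open Scope ring_scope.

(** Let x lie in the stratum of signature (r, s) and let m = i - r - s be the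
    dimension of the radical of b on x.  Choose a basis e1, e2 of x such that e1
    has Gram matrix diag(1_r, -1_s) and e2 spans the radical.  Subspaces near x
    are graphs over x, and in the graph basis the Gram matrix of b has blocks
    P, Q, Q^T, S with P close to diag(1_r, -1_s).  By additivity of inertia
    ([schur_split]) the signature of b on the graph is (r, s) plus the signature
    of the Schur complement sigma = S - Q^T P^-1 Q, a symmetric m x m matrix.
    So the whole statement says that sigma, as a function on the Grassmannian,
    is in a submersion normal form near x ([stratumP]).

    No inverse function theorem is needed to put it in normal form, because the
    complement F of x that defines the graph chart can be chosen well: F contains
    an isotropic family f1 that is b-dual to e2 and b-orthogonal to e1, and F is
    b-orthogonal to f1 ([exists_hyperbolic_frame]).  Translating the second half
    of the graph by tau f1 / 2, with tau symmetric, then leaves P and Q alone and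
    adds tau to S, so that sigma (X + push tau) = sigma X + tau holds exactly
    ([schur_push]).  Consequently
    - X |-> (X - push (sigma X), sigma X) is a diffeomorphism onto the product of
      the zero set of sigma and the symmetric matrices, with inverse
      (X, tau) |-> X + push tau ([local_diffeo]);
    - if T is a linear map with the same translation property, for instance the
      differential of sigma at x, the shear X |-> X + push (sigma X - T X) is
      invertible and carries the zero set of sigma into the kernel of T; this
      gives slice charts ([local_slice_chart]), in which the codimension is the
      dimension of the space of symmetric forms, the same at every point.

    Two bodies of elementary facts support this.  Every map involved is rational
    in matrix entries, so smoothness follows from the stability of smooth scalar
    functions under sums, products and inverses, with Cramer's rule for inverse
    matrices.  Signatures are handled through certificates ([pos_split]): a
    positive definite subspace and a complementary-dimensional nonpositive one,
    which add up along orthogonal sums, unlike the maximal dimensions that define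
    the signature. *)

(** * Smooth maps between matrix spaces *)

Lemma Ck_on_sub (R : realType) (V W : normedModType R) k (D E : set V)
  (f : V -> W) : E `<=` D -> Ck_on k D f -> Ck_on k E f.
Proof.
move=> ED; elim: k f => [|k IH] f /=; first by move=> h x /ED; apply: h.
by case=> h1 h2; split=> [x /ED|v]; [apply: h1|apply: IH].
Qed.

Lemma smooth_on_sub (R : realType) (V W : normedModType R) (D E : set V)
  (f : V -> W) : E `<=` D -> smooth_on D f -> smooth_on E f.
Proof. by move=> ED h k; apply: Ck_on_sub (h k). Qed.

Lemma near_open (T : topologicalType) (D : set T) (P : T -> Prop) x :
  open D -> D x -> (forall y, D y -> P y) -> \forall y \near x, P y.
Proof.
move=> oD Dx h; have := open_nbhs_nbhs (conj oD Dx).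
by apply: filterS => y /h.
Qed.

Lemma near_eq_differentiable (R : realType) (V W : normedModType R)
  (f g : V -> W) x : (\forall y \near x, f y = g y) ->
  differentiable f x -> differentiable g x.
Proof.
move=> fg /diff_locallyP [dfc /eqaddoP df].
have gx : g x = f x by rewrite (nbhs_singleton fg).
have dg : g \o shift x = cst (g x) + 'd f x +o_ 0 id.
  apply/eqaddoP => e e0; have := df e e0.
  have fg0 : \forall h \near (0 : V), f (h + x) = g (h + x).
    by move: fg; rewrite (near_shift 0) => /=; rewrite subr0.
  apply: filterS2 fg0 => h /= fgh.
  by rewrite /= !fctE gx -fgh.
by apply/diff_locallyP; rewrite (diff_unique dfc dg).
Qed.

(** The formulas for the derivatives of sums, products and inverses are only
    valid on D, whereas ['D_v f] is a function on the whole space.  Openness of D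
    makes the derivatives on D depend on the values on D alone, which is how
    these formulas are used below. *)
Lemma Ck_on_ext (R : realType) (V W : normedModType R) k (D : set V)
  (f g : V -> W) : open D -> (forall x, D x -> f x = g x) ->
  Ck_on k D f -> Ck_on k D g.
Proof.
move=> oD; elim: k f g => [|k IH] f g fg /=.
  move=> h x Dx; rewrite /prop_for/=/continuous_at -(fg _ Dx).
  apply: cvg_trans (h x Dx); apply: near_eq_cvg.
  exact: (near_open oD Dx).
case=> h1 h2; split=> [x Dx|v].
  by apply: near_eq_differentiable (h1 x Dx); exact: (near_open oD Dx).
apply: IH (h2 v) => x Dx; apply: near_eq_derive.
exact: (near_open oD Dx).
Qed.

Lemma Ck_on_pred (R : realType) (V W : normedModType R) k (D : set V)
  (f : V -> W) : Ck_on k.+1 D f -> Ck_on k D f.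
Proof.
elim: k f => [|k IH] f [h1 h2].
  by move=> x /h1; apply: differentiable_continuous.
by split=> // v; apply: IH.
Qed.

Lemma Ck_on_cst (R : realType) (V W : normedModType R) k (D : set V)
  (a : W) : Ck_on k D (cst a : V -> W).
Proof.
elim: k a => [|k IH] a /=; first by move=> x _; apply: cst_continuous.
split=> [x _|v]; first exact: differentiable_cst.
rewrite (_ : 'D_v _ = cst 0); first exact: IH.
by apply/funext => x; rewrite derive_cst.
Qed.

Section closure.
Context (R : realType) (V : normedModType R) (D : set V) (oD : open D).

Lemma Ck_onD (W : normedModType R) k (f g : V -> W) :
  Ck_on k D f -> Ck_on k D g -> Ck_on k D (fun x => f x + g x).
Proof.
elim: k f g => [|k IH] f g /=.
  by move=> hf hg x Dx; apply: continuousD; [apply: hf|apply: hg].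
case=> f1 f2 [g1 g2]; split=> [x Dx|v].
  by apply: differentiableD; [apply: f1|apply: g1].
apply: Ck_on_ext (IH _ _ (f2 v) (g2 v)) => // x Dx.
by rewrite deriveD //; apply: diff_derivable; [apply: f1|apply: g1].
Qed.

(** The Leibniz rule expresses a derivative of the product by products of a
    factor with a derivative; the induction needs the factors themselves to be of
    the lower class. *)
Lemma Ck_onM k (f g : V -> R) :
  Ck_on k D f -> Ck_on k D g -> Ck_on k D (fun x => f x * g x).
Proof.
elim: k f g => [|k IH] f g.
  by move=> hf hg x Dx; apply: continuousM; [apply: hf|apply: hg].
move=> hf hg; have f0 := Ck_on_pred hf; have g0 := Ck_on_pred hg.
case: hf hg => f1 f2 [g1 g2]; split=> [x Dx|v].
  by apply: differentiableM; [apply: f1|apply: g1].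
apply: Ck_on_ext (Ck_onD (IH _ _ f0 (g2 v)) (IH _ _ g0 (f2 v))) => // x Dx.
by rewrite [RHS]deriveM //; apply: diff_derivable; [apply: f1|apply: g1].
Qed.

Lemma Ck_onV k (f : V -> R) : (forall x, D x -> f x != 0) ->
  Ck_on k D f -> Ck_on k D (fun x => (f x)^-1).
Proof.
move=> fn0; elim: k => [|k IH].
  by move=> hf x Dx; apply: continuousV; [apply: fn0|apply: hf].
move=> hf; have /IH f0 := Ck_on_pred hf.
case: hf => f1 f2; split=> [x Dx|v].
  by apply: differentiableV; [apply: f1|apply: fn0].
have h := Ck_onM (Ck_onM f0 f0) (Ck_onM (@Ck_on_cst R V R k D (-1)) (f2 v)).
apply: Ck_on_ext h => // x Dx.
rewrite [RHS]deriveV; [|exact: fn0|exact/diff_derivable/f1].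
by rewrite /cst /= mulN1r mulrN scaleNr expr2 invfM.
Qed.

Lemma Ck_onZl (W : normedModType R) k (f : V -> R) (w : W) :
  Ck_on k D f -> Ck_on k D (fun x => f x *: w).
Proof.
elim: k f => [|k IH] f.
  by move=> hf x Dx; apply: cvgZr_tmp; apply: hf.
case=> f1 f2; split=> [x Dx|v].
  by apply: differentiableZl; apply: f1.
apply: Ck_on_ext (IH _ (f2 v)) => // x Dx.
rewrite [RHS]deriveE; last by apply: differentiableZl; apply: f1.
by rewrite diffZl ?deriveE //; apply: f1.
Qed.

Lemma Ck_on_linear (W : normedModType R) k (f : {linear V -> W}) :
  continuous f -> Ck_on k D f.
Proof.
move=> fc; case: k => [|k] /=; first by move=> x _; apply: fc.
split=> [x _|v]; first exact: linear_differentiable.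
apply: Ck_on_ext (Ck_on_cst k D (f v)) => // x Dx.
by rewrite deriveE ?diff_lin //; apply: linear_differentiable.
Qed.
End closure.

(** Smoothness entry by entry, so that rational expressions in matrices can be
    handled by the stability properties of scalar functions, without a chain
    rule. *)
Definition smooth_mx (R : realType) (V : normedModType R) (D : set V) m n
  (F : V -> 'M[R]_(m, n)) : Prop :=
  forall i j, smooth_on D (fun x => F x i j : R).

Section matrices.
Context (R : realType) (V : normedModType R) (D : set V) (oD : open D).

Lemma smooth_mx_ext m n (F G : V -> 'M[R]_(m, n)) :
  (forall x, D x -> F x = G x) -> smooth_mx D F -> smooth_mx D G.
Proof.
move=> FG hF i j k; apply: Ck_on_ext (hF i j k) => // x Dx.
by rewrite FG.
Qed.

Lemma smooth_mx_cst m n (M : 'M[R]_(m, n)) : smooth_mx D (fun=> M).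
Proof. by move=> i j k; apply: (@Ck_on_cst R V R). Qed.

Lemma smooth_sum I (r : seq I) (P : pred I) (F : I -> V -> R) :
  (forall i, smooth_on D (F i)) ->
  smooth_on D (fun x => \sum_(i <- r | P i) F i x).
Proof.
move=> hF k; elim: r => [|i r IH].
  apply: Ck_on_ext (@Ck_on_cst R V R k D 0) => // x _.
  by rewrite big_nil.
case: (boolP (P i)) => Pi.
  apply: Ck_on_ext (Ck_onD oD (hF i k) IH) => // x _.
  by rewrite big_cons Pi.
apply: Ck_on_ext IH => // x _.
by rewrite big_cons (negbTE Pi).
Qed.

Lemma smooth_prod I (r : seq I) (P : pred I) (F : I -> V -> R) :
  (forall i, smooth_on D (F i)) ->
  smooth_on D (fun x => \prod_(i <- r | P i) F i x).
Proof.
move=> hF k; elim: r => [|i r IH].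
  apply: Ck_on_ext (@Ck_on_cst R V R k D 1) => // x _.
  by rewrite big_nil.
case: (boolP (P i)) => Pi.
  apply: Ck_on_ext (Ck_onM oD (hF i k) IH) => // x _.
  by rewrite big_cons Pi.
apply: Ck_on_ext IH => // x _.
by rewrite big_cons (negbTE Pi).
Qed.

Lemma smooth_mxD m n (F G : V -> 'M[R]_(m, n)) :
  smooth_mx D F -> smooth_mx D G -> smooth_mx D (fun x => F x + G x).
Proof.
move=> hF hG i j k; apply: Ck_on_ext (Ck_onD oD (hF i j k) (hG i j k)) => //.
by move=> x _; rewrite mxE.
Qed.

Lemma smooth_mxM m n p (F : V -> 'M[R]_(m, n)) (G : V -> 'M[R]_(n, p)) :
  smooth_mx D F -> smooth_mx D G -> smooth_mx D (fun x => F x *m G x).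
Proof.
move=> hF hG i j k.
have h : smooth_on D (fun x => \sum_l F x i l * G x l j).
  by apply: smooth_sum => l k'; exact: (Ck_onM oD (hF i l k') (hG l j k')).
by apply: Ck_on_ext (h k) => // x _; rewrite mxE.
Qed.

Lemma smooth_mxN m n (F : V -> 'M[R]_(m, n)) :
  smooth_mx D F -> smooth_mx D (fun x => - F x).
Proof.
move=> hF; apply: smooth_mx_ext (smooth_mxM (smooth_mx_cst (-1)) hF) => x _.
by rewrite mulNmx mul1mx.
Qed.

Lemma smooth_mxB m n (F G : V -> 'M[R]_(m, n)) :
  smooth_mx D F -> smooth_mx D G -> smooth_mx D (fun x => F x - G x).
Proof. by move=> hF hG; apply: smooth_mxD => //; apply: smooth_mxN. Qed.

Lemma smooth_trmx m n (F : V -> 'M[R]_(m, n)) :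
  smooth_mx D F -> smooth_mx D (fun x => (F x)^T).
Proof.
move=> hF i j k; apply: Ck_on_ext (hF j i k) => // x _.
by rewrite mxE.
Qed.

Lemma smooth_mxvec m n (F : V -> 'M[R]_(m, n)) :
  smooth_mx D F -> smooth_mx D (fun x => mxvec (F x)).
Proof.
move=> hF i j k; case/mxvec_indexP: j => a b.
by apply: Ck_on_ext (hF a b k) => // x _; rewrite (ord1 i) mxvecE.
Qed.

Lemma smooth_vec_mx m n (F : V -> 'rV[R]_(m * n)) :
  smooth_mx D F -> smooth_mx D (fun x => vec_mx (F x) : 'M[R]_(m, n)).
Proof.
move=> hF i j k; apply: Ck_on_ext (hF ord0 (mxvec_index i j) k) => // x _.
by rewrite mxE.
Qed.

Lemma smooth_row_mx m n p (F : V -> 'M[R]_(m, n)) (G : V -> 'M[R]_(m, p)) :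
  smooth_mx D F -> smooth_mx D G -> smooth_mx D (fun x => row_mx (F x) (G x)).
Proof.
move=> hF hG i j k; case: (split_ordP j) => l ->.
  by apply: Ck_on_ext (hF i l k) => // x _; rewrite row_mxEl.
by apply: Ck_on_ext (hG i l k) => // x _; rewrite row_mxEr.
Qed.

Lemma smooth_det n (F : V -> 'M[R]_n) :
  smooth_mx D F -> smooth_on D (fun x => \det (F x)).
Proof.
move=> hF; apply: smooth_sum => s k.
have h : smooth_on D (fun x => \prod_i F x i (perm.fun_of_perm s i)).
  exact: smooth_prod.
exact: (Ck_onM oD (@Ck_on_cst R V R k D _) (h k)).
Qed.

(** Cramer's rule: the entries of the inverse are cofactors over the
    determinant. *)
Lemma smooth_invmx n (F : V -> 'M[R]_n) :
  (forall x, D x -> F x \in unitmx) ->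
  smooth_mx D F -> smooth_mx D (fun x => invmx (F x)).
Proof.
move=> Fu hF i j k.
have h1 : smooth_on D (fun x => cofactor (F x) j i).
  have h : smooth_on D (fun x => \det (row' j (col' i (F x)))).
    apply: smooth_det => a b l.
    by apply: Ck_on_ext (hF (lift j a) (lift i b) l) => // x _; rewrite !mxE.
  move=> l; exact: (Ck_onM oD (@Ck_on_cst R V R l D ((-1) ^+ (j + i))) (h l)).
have h2 : Ck_on k D (fun x => (\det (F x))^-1).
  apply: Ck_onV => //; last exact: smooth_det.
  by move=> x /Fu; rewrite unitmxE unitfE.
apply: Ck_on_ext (Ck_onM oD h2 (h1 k)) => // x Dx.
by rewrite /invmx Fu // !mxE.
Qed.

Lemma smooth_mx_on m n (F : V -> 'M[R]_(m, n)) :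
  smooth_mx D F -> smooth_on D F.
Proof.
move=> hF k.
have h (r : seq ('I_m * 'I_n)) : Ck_on k D
    (fun x => \sum_(p <- r) F x p.1 p.2 *: delta_mx p.1 p.2 : 'M[R]_(m, n)).
  elim: r => [|p r IH].
    apply: Ck_on_ext (Ck_on_cst k D (0 : 'M[R]_(m, n))) => // x _.
    by rewrite big_nil.
  pose E : 'M[R]_(m, n) := delta_mx p.1 p.2.
  apply: Ck_on_ext (Ck_onD oD (Ck_onZl oD E (hF p.1 p.2 k)) IH) => //.
  by move=> x _; rewrite big_cons.
apply: Ck_on_ext (h (index_enum _)) => // x _.
by rewrite [RHS]matrix_sum_delta pair_big.
Qed.

Lemma open_preimage (T : topologicalType) (f : V -> T) (E : set T) :
  (forall x, D x -> {for x, continuous f}) -> open E ->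
  open [set x | D x /\ E (f x)].
Proof.
move=> fc oE; rewrite openE => x [Dx Ex].
have h1 : \forall y \near x, D y by exact: open_nbhs_nbhs.
have h2 : \forall y \near x, E (f y).
  by apply: (fc x Dx); apply: open_nbhs_nbhs.
exact: filterI h1 h2.
Qed.

Lemma open_det_neq0 n (F : V -> 'M[R]_n) : smooth_mx D F ->
  open [set x | D x /\ F x \in unitmx].
Proof.
move=> /smooth_det hF.
have -> : [set x | D x /\ F x \in unitmx] =
  [set x | D x /\ [set y : R | y != 0] (\det (F x))].
  by apply/seteqP; split=> x /=; rewrite unitmxE unitfE.
apply: open_preimage; first exact: (hF 0%N).
exact: open_neq.
Qed.
End matrices.

Lemma smooth_mx_id (R : realType) d (D : set 'rV[R]_d) : open D ->
  smooth_mx D (fun x => x).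
Proof.
move=> oD i j k.
have @f : {linear 'rV[R]_d -> R}.
  by exists (fun N : 'rV[R]_d => N i j); do 2![eexists]; do ?[constructor];
     rewrite ?mxE// => ? *; rewrite ?mxE//; move=> ?; rewrite !mxE.
exact: (@Ck_on_linear R _ D oD R k f (@coord_continuous _ _ _ i j)).
Qed.

(** * Subspaces as row spans *)

Section rowspans.
Context (R : realType).

Lemma memv_rowspan m n (M : 'M[R]_(m, n)) x :
  reflect (exists u, x = u *m M) (x \in rowspan M).
Proof.
apply: (iffP idP) => [|[u ->]].
  rewrite /rowspan => /(@coord_span _ _ _ (in_tuple _)) ->.
  pose in_span (y : 'rV[R]_n) := exists u, y = u *m M.
  apply: (big_ind in_span) => [|_ _ [u ->] [v ->]|k _].
  - by exists 0; rewrite mul0mx.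
  - by exists (u + v); rewrite mulmxDl.
  - have /mapP[j _ ->] := mem_nth 0 (ltn_ord k).
    by eexists (_ *: delta_mx 0 j); rewrite -scalemxAl -rowE.
rewrite mulmx_sum_row; apply: memv_suml => j _; apply/memvZ/memv_span.
by apply/mapP; exists j; rewrite ?mem_enum.
Qed.

Lemma rowspan_le m p n (M : 'M[R]_(m, n)) (N : 'M[R]_(p, n)) :
  (rowspan M <= rowspan N)%VS <-> exists A, M = A *m N.
Proof.
split=> [/subvP h|[A ->]]; last first.
  apply/subvP => x /memv_rowspan [u ->]; apply/memv_rowspan.
  by exists (u *m A); rewrite mulmxA.
apply/submxP/row_subP => j; apply/submxP.
by apply/memv_rowspan/h/memv_rowspan; exists (delta_mx 0 j); rewrite -rowE.
Qed.

Lemma rowspan_mul m n (A : 'M[R]_m) (M : 'M[R]_(m, n)) :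
  A \in unitmx -> rowspan (A *m M) = rowspan M.
Proof.
move=> Au; apply/eqP; rewrite eqEsubv; apply/andP; split; apply/rowspan_le.
  by exists A.
by exists (invmx A); rewrite mulKmx.
Qed.

Lemma rowspan_col m p n (M : 'M[R]_(m, n)) (N : 'M[R]_(p, n)) :
  rowspan (col_mx M N) = (rowspan M + rowspan N)%VS.
Proof.
apply/vspaceP => x; apply/memv_rowspan/memv_addP => [[u ->]|].
  rewrite -[u]hsubmxK mul_row_col.
  exists (lsubmx u *m M); first by apply/memv_rowspan; eexists.
  by exists (rsubmx u *m N) => //; apply/memv_rowspan; eexists.
move=> [_ /memv_rowspan[u ->] [_ /memv_rowspan[v ->] ->]].
by exists (row_mx u v); rewrite mul_row_col.
Qed.

Lemma row_free_kerP m n (M : 'M[R]_(m, n)) :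
  row_free M <-> (forall u : 'rV_m, u *m M = 0 -> u = 0).
Proof.
split=> [/row_free_inj h u uM|h]; first by apply: h; rewrite uM mul0mx.
rewrite -kermx_eq0; apply/eqP/row_matrixP => i; rewrite row0.
apply: h; apply/eqP; rewrite -sub_kermx; exact: row_sub.
Qed.

Lemma rowspan_limg m n (M : 'M[R]_(m, n)) :
  rowspan M = limg (linfun (mulmxr M : 'rV[R]_m -> 'rV[R]_n)).
Proof.
apply/vspaceP => x; apply/memv_rowspan/memv_imgP => [[u ->]|[u _ ->]].
  by exists u; rewrite ?memvf ?lfunE.
by exists u; rewrite lfunE.
Qed.

Lemma lker_mulmxr m n (M : 'M[R]_(m, n)) : row_free M ->
  lker (linfun (mulmxr M : 'rV[R]_m -> 'rV[R]_n)) = 0%VS.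
Proof.
move=> /row_free_kerP h; apply/eqP; rewrite -subv0; apply/subvP => u.
by rewrite memv_ker lfunE /= memv0 => /eqP /h ->.
Qed.

Lemma dim_rowspan m n (M : 'M[R]_(m, n)) : row_free M -> \dim (rowspan M) = m.
Proof.
move=> /lker_mulmxr h; rewrite rowspan_limg limg_dim_eq ?dimvf /dim /= ?mul1n //.
by rewrite h capv0.
Qed.

Lemma rowspanK n (W : {vspace 'rV[R]_n}) k : \dim W = k ->
  exists2 M : 'M[R]_(k, n), W = rowspan M & row_free M.
Proof.
move=> <-; pose M : 'M[R]_(\dim W, n) := \matrix_i (vbasis W)`_i.
have Ms (u : 'rV_(\dim W)) : u *m M = \sum_i u 0 i *: (vbasis W)`_i.
  by rewrite mulmx_sum_row; apply: eq_bigr => i _; rewrite rowK.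
have fM : row_free M.
  apply/row_free_kerP => u; rewrite Ms => h.
  have /freeP/(_ (fun i => u 0 i) h) := basis_free (vbasisP W).
  by move=> u0; apply/rowP => i; rewrite u0 mxE.
exists M => //; apply/vspaceP => x; apply/idP/memv_rowspan => [xW|[u ->]].
  exists (\row_i coord (vbasis W) i x); rewrite Ms {1}(coord_vbasis xW).
  by apply: eq_bigr => i _; rewrite mxE.
rewrite Ms; apply: memv_suml => i _; apply/memvZ/vbasis_mem.
by rewrite mem_nth // size_tuple.
Qed.
End rowspans.

(** * Certificates for the signature *)

Definition bf (R : realType) n (B : 'M[R]_n) (x y : 'rV[R]_n) : R :=
  (x *m B *m y^T) ord0 ord0.

Section bilinear.
Context (R : realType) (n : nat).
Implicit Types (B : 'M[R]_n) (x y z : 'rV[R]_n) (W P N : {vspace 'rV[R]_n}).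

Lemma bfDl B x y z : bf B (x + y) z = bf B x z + bf B y z.
Proof. by rewrite /bf !mulmxDl mxE. Qed.

Lemma bfDr B x y z : bf B x (y + z) = bf B x y + bf B x z.
Proof. by rewrite /bf linearD mulmxDr mxE. Qed.

Lemma bf0l B y : bf B 0 y = 0.
Proof. by rewrite /bf !mul0mx mxE. Qed.

Lemma bfZl B a x y : bf B (a *: x) y = a * bf B x y.
Proof. by rewrite /bf -!scalemxAl mxE. Qed.

Lemma bfZr B a x y : bf B x (a *: y) = a * bf B x y.
Proof. by rewrite /bf linearZ -scalemxAr mxE. Qed.

Lemma bfC B x y : B^T = B -> bf B x y = bf B y x.
Proof.
move=> sB; rewrite /bf.
have := congr1 (fun M : 'M[R]_1 => M ord0 ord0) (erefl (x *m B *m y^T)^T).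
by rewrite {1}mxE !trmx_mul trmxK sB mulmxA => ->.
Qed.

Lemma bfDm B C x y : bf (B + C) x y = bf B x y + bf C x y.
Proof. by rewrite /bf mulmxDr mulmxDl mxE. Qed.

Lemma bfN B x y : bf (- B) x y = - bf B x y.
Proof. by rewrite /bf mulmxN mulNmx mxE. Qed.

Lemma bf_mul m B (M : 'M[R]_(m, n)) u v :
  bf B (u *m M) (v *m M) = bf (M *m B *m M^T) u v.
Proof. by rewrite /bf trmx_mul !mulmxA. Qed.

Lemma bf_mul0 m p B (M : 'M[R]_(m, n)) (N : 'M[R]_(p, n)) u v :
  M *m B *m N^T = 0 -> bf B (u *m M) (v *m N) = 0.
Proof.
move=> h; rewrite /bf trmx_mul -!mulmxA (mulmxA M) (mulmxA (M *m B)) h.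
by rewrite !(mul0mx, mulmx0) mxE.
Qed.

Definition nonpos_on (b : 'rV[R]_n -> 'rV[R]_n -> R) W : Prop :=
  forall x, x \in W -> b x x <= 0.

(** A certificate that r is the largest dimension of a positive definite subspace
    of W: P attains it, and N bounds it since a positive definite subspace meets
    N only in 0. *)
Definition pos_split B W (r : nat) : Prop := exists P N,
  [/\ (P <= W)%VS /\ (N <= W)%VS, posdef_on (bf B) P, nonpos_on (bf B) N,
    \dim P = r & (\dim P + \dim N = \dim W)%N].

Lemma max_dim_uniq (Q : {vspace 'rV[R]_n} -> Prop) r s :
  max_dim Q r -> max_dim Q s -> r = s.
Proof.
move=> [[F QF Fr] mr] [[G QG Gs] ms]; apply/eqP; rewrite eqn_leq.
by rewrite -{1}Fr (ms _ QF) -Gs (mr _ QG).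
Qed.

Lemma posdef_nonpos_dim B W P N : (P <= W)%VS -> (N <= W)%VS ->
  posdef_on (bf B) P -> nonpos_on (bf B) N -> (\dim P + \dim N <= \dim W)%N.
Proof.
move=> PW NW hP hN; rewrite -dimv_disjoint_sum.
  by apply: dimvS; rewrite subv_add PW.
apply/eqP; rewrite -subv0; apply/subvP => x; rewrite memv_cap memv0.
case/andP=> xP xN; apply/eqP/eqP/negPn/negP => x0.
by have := lt_le_trans (hP _ xP x0) (hN _ xN); rewrite ltxx.
Qed.

Lemma pos_split_max B W r : pos_split B W r ->
  max_dim (fun F => (F <= W)%VS /\ posdef_on (bf B) F) r.
Proof.
case=> P [N [[PW NW] hP hN Pr dPN]]; split; first by exists P.
move=> F [FW hF]; have := posdef_nonpos_dim FW NW hF hN.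
by rewrite -dPN Pr leq_add2r.
Qed.

Lemma posdef_add B P P' : (forall x y, x \in P -> y \in P' ->
    bf B x y = 0 /\ bf B y x = 0) ->
  posdef_on (bf B) P -> posdef_on (bf B) P' -> posdef_on (bf B) (P + P')%VS.
Proof.
move=> o hP hP' _ /memv_addP[x xP [y yP ->]].
have [e1 e2] := o x y xP yP.
rewrite !(bfDl, bfDr) e1 e2 add0r addr0.
have [->|x0] := eqVneq x 0; have [->|y0] := eqVneq y 0; rewrite ?addr0 ?eqxx //.
- by move=> _; rewrite bf0l add0r; exact: hP'.
- by move=> _; rewrite bf0l addr0; exact: hP.
- by move=> _; apply: addr_gt0; [exact: hP|exact: hP'].
Qed.

Lemma nonpos_add B P P' : (forall x y, x \in P -> y \in P' ->
    bf B x y = 0 /\ bf B y x = 0) ->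
  nonpos_on (bf B) P -> nonpos_on (bf B) P' -> nonpos_on (bf B) (P + P')%VS.
Proof.
move=> o hP hP' _ /memv_addP[x xP [y yP ->]].
have [e1 e2] := o x y xP yP.
rewrite !(bfDl, bfDr) e1 e2 add0r addr0.
by have := hP x xP; have := hP' y yP; lra.
Qed.

(** Both halves of the certificate add up along an orthogonal direct sum; the
    maximality in the definition of the signature could not be added up
    directly. *)
Lemma pos_split_add B W W' r r' : (W :&: W' = 0)%VS ->
  (forall x y, x \in W -> y \in W' -> bf B x y = 0 /\ bf B y x = 0) ->
  pos_split B W r -> pos_split B W' r' -> pos_split B (W + W')%VS (r + r').
Proof.
move=> dWW' o [P [N [[PW NW] hP hN Pr dPN]]] [P' [N' [[PW' NW'] hP' hN' Pr' dPN']]].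
have dimD (U U' : {vspace 'rV[R]_n}) : (U <= W)%VS -> (U' <= W')%VS ->
    \dim (U + U') = (\dim U + \dim U')%N.
  move=> UW UW'; apply: dimv_disjoint_sum; apply/eqP; rewrite -subv0 -dWW'.
  by rewrite subv_cap (subv_trans (capvSl _ _)) // (subv_trans (capvSr _ _)).
exists (P + P')%VS, (N + N')%VS; split.
- by split; apply: addvS.
- apply: posdef_add => // x y xP yP.
  by apply: o; [apply: subvP xP|apply: subvP yP].
- apply: nonpos_add => // x y xP yP.
  by apply: o; [apply: subvP xP|apply: subvP yP].
- by rewrite dimD // Pr Pr'.
- by rewrite !dimD //; lia.
Qed.
End bilinear.

Lemma pos_split_img (R : realType) m n (B : 'M[R]_n) (M : 'M[R]_(m, n)) r :
  row_free M -> pos_split (M *m B *m M^T) fullv r -> pos_split B (rowspan M) r.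
Proof.
move=> fM [P [N [_ hP hN Pr dPN]]].
pose f := linfun (mulmxr M : 'rV[R]_m -> 'rV[R]_n).
have dimf (U : {vspace 'rV[R]_m}) : \dim (f @: U) = \dim U.
  by rewrite limg_dim_eq // lker_mulmxr // capv0.
rewrite rowspan_limg; exists (f @: P)%VS, (f @: N)%VS; split.
- by split; apply/limgS/subvf.
- move=> _ /memv_imgP[u uP ->]; rewrite lfunE /= bf_mul => h.
  by apply: hP => //; apply: contraNneq h => ->; rewrite mul0mx.
- by move=> _ /memv_imgP[u uN ->]; rewrite lfunE /= bf_mul; apply: hN.
- by rewrite dimf.
- by rewrite !dimf.
Qed.

(** The negative index of B is treated as the positive index of - B. *)
Definition sig_split (R : realType) n (B : 'M[R]_n) W r s :=
  pos_split B W r /\ pos_split (- B) W s.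

Lemma negdef_posdef (R : realType) n (B : 'M[R]_n) F :
  negdef_on (bf B) F <-> posdef_on (bf (- B)) F.
Proof. by split=> h x xF x0; have := h x xF x0; rewrite bfN oppr_gt0. Qed.

Lemma sig_split_signature (R : realType) n (B : 'M[R]_n) W r s :
  sig_split B W r s -> signature_on (bf B) W r s.
Proof.
case=> h1 h2; split; first exact: pos_split_max.
have -> : (fun F => (F <= W)%VS /\ negdef_on (bf B) F) =
   (fun F => (F <= W)%VS /\ posdef_on (bf (- B)) F).
  by apply/funext => F; apply/propext; rewrite negdef_posdef.
exact: pos_split_max.
Qed.

Lemma signature_uniq (R : realType) n (b : 'rV[R]_n -> 'rV[R]_n -> R) W r s r' s' :
  signature_on b W r s -> signature_on b W r' s' -> r = r' /\ s = s'.
Proof. by move=> [h1 h2] [h3 h4]; split; apply: max_dim_uniq; eassumption. Qed.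

Lemma rowspan_row (R : realType) n (v : 'rV[R]_n) : rowspan v = <[v]>%VS.
Proof.
apply/vspaceP => x; apply/memv_rowspan/vlineP => [[u ->]|[a ->]].
  by exists (u 0 0); rewrite {1}[u]mx11_scalar mul_scalar_mx.
by exists a%:M; rewrite mul_scalar_mx.
Qed.

Lemma bf1 (R : realType) m (u : 'rV[R]_m) : bf 1%:M u u = \sum_j u 0 j ^+ 2.
Proof.
by rewrite /bf mulmx1 mxE; apply: eq_bigr => j _; rewrite mxE expr2.
Qed.

Lemma bf1_gt0 (R : realType) m (u : 'rV[R]_m) : u != 0 -> 0 < bf 1%:M u u.
Proof.
move=> u0; rewrite bf1 lt_def sumr_ge0 ?andbT => [|j _]; last exact: sqr_ge0.
apply: contra u0 => /eqP h; apply/eqP/rowP => j; rewrite mxE; apply/eqP.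
rewrite -sqrf_eq0; apply/eqP; move: j (erefl true).
by apply: psumr_eq0P h => j _; apply: sqr_ge0.
Qed.

Lemma gram_eq0 (R : realType) n (B : 'M[R]_n) m p (M : 'M[R]_(m, n))
  (N : 'M[R]_(p, n)) :
  (forall x y, x \in rowspan M -> y \in rowspan N -> bf B x y = 0) ->
  M *m B *m N^T = 0.
Proof.
move=> h; apply/matrixP => i j; rewrite [RHS]mxE.
rewrite -(h (delta_mx 0 i *m M) (delta_mx 0 j *m N)).
- rewrite /bf trmx_mul trmx_delta !mulmxA -[_ *m M *m B]mulmxA -mulmxA.
  by rewrite -rowE mulmxA -row_mul -colE !mxE.
- by apply/memv_rowspan; eexists.
- by apply/memv_rowspan; eexists.
Qed.

(** * Diagonalization and stability of signatures *)

Section sylvester.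
Context (R : realType) (n : nat) (B : 'M[R]_n) (sB : B^T = B).

Record sylvester_basis (W : {vspace 'rV[R]_n}) r s m (ep : 'M[R]_(r, n))
    (en : 'M[R]_(s, n)) (e0 : 'M[R]_(m, n)) : Prop := SylvesterBasis {
  syl_span : W = (rowspan ep + rowspan en + rowspan e0)%VS;
  syl_dim : (r + s + m = \dim W)%N;
  syl_pp : ep *m B *m ep^T = 1%:M;
  syl_nn : en *m B *m en^T = - 1%:M;
  syl_00 : e0 *m B *m e0^T = 0;
  syl_pn : ep *m B *m en^T = 0;
  syl_p0 : ep *m B *m e0^T = 0;
  syl_n0 : en *m B *m e0^T = 0 }.

Lemma split_off (W : {vspace 'rV[R]_n}) v : v \in W -> bf B v v != 0 ->
  exists W' : {vspace 'rV[R]_n}, [/\ W = (<[v]> + W')%VS, (\dim W').+1 = \dim W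
    & forall x, x \in W' -> bf B v x = 0].
Proof.
move=> vW v0.
pose f := linfun (mulmxr (B *m v^T) : 'rV[R]_n -> 'rV[R]_1).
have fE x : (f x == 0) = (bf B v x == 0).
  rewrite lfunE /= mulmxA (bfC v) // /bf; apply/eqP/eqP => [->|h]; first by rewrite mxE.
  by apply/matrixP => i j; rewrite !ord1 h mxE.
have W'P x : (x \in W :&: lker f)%VS = (x \in W) && (bf B v x == 0).
  by rewrite memv_cap memv_ker fE.
have eW : W = (<[v]> + (W :&: lker f))%VS.
  apply/vspaceP => x; apply/idP/memv_addP => [xW|[_ /vlineP[a ->] [y]]]; last first.
    by rewrite W'P => /andP[yW _] ->; rewrite memvD // memvZ.
  pose a := bf B v x / bf B v v.
  exists (a *: v); first by rewrite memvZ // memv_line.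
  exists (x - a *: v); last by rewrite addrC subrK.
  rewrite W'P memvB ?memvZ //= bfDr -scaleN1r !bfZr /a.
  by rewrite mulN1r divfK // subrr.
exists (W :&: lker f)%VS; split=> // [|x]; last by rewrite W'P => /andP[_ /eqP].
rewrite [in RHS]eW dimv_disjoint_sum.
  by rewrite dim_vline; case: (v =P 0) v0 => [->|_ _]; rewrite ?bf0l ?eqxx ?add1n.
apply/eqP; rewrite -subv0; apply/subvP => x.
rewrite memv_cap W'P memv0 => /andP[/vlineP[a ->] /andP[_]].
by rewrite bfZr mulf_eq0 (negbTE v0) orbF => /eqP ->; rewrite scale0r.
Qed.

Lemma gram_tr0 p q (M : 'M[R]_(p, n)) (N : 'M[R]_(q, n)) :
  M *m B *m N^T = 0 -> N *m B *m M^T = 0.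
Proof.
by move=> /(congr1 trmx); rewrite !trmx_mul trmxK sB trmx0 mulmxA.
Qed.

(** Polarization: a form vanishing on the diagonal of W vanishes on W. *)
Lemma isotropic_basis (W : {vspace 'rV[R]_n}) : (forall v, v \in W -> bf B v v = 0) ->
  exists e0 : 'M[R]_(\dim W, n), @sylvester_basis W 0 0 (\dim W) 0 0 e0.
Proof.
move=> h; have [e0 We0 _] := rowspanK (erefl (\dim W)).
have h0 p (M : 'M[R]_(0, p)) : M = 0 by apply/matrixP => -[].
exists e0; split=> //; try by rewrite [LHS]h0 [RHS]h0.
- suff e : rowspan (0 : 'M[R]_(0, n)) = 0%VS by rewrite e !add0v.
  apply/eqP; rewrite -subv0; apply/subvP => x /memv_rowspan[u ->].
  by rewrite mulmx0 mem0v.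
- apply: gram_eq0 => x y; rewrite -We0 => xW yW.
  have := h _ (memvD xW yW); rewrite !(bfDl, bfDr) (h x xW) (h y yW) (bfC y) //.
  by rewrite add0r addr0 => H; have : bf B x y *+ 2 = 0; [rewrite mulr2n|lra].
Qed.

Lemma gram_col p q p' q' (a : 'M[R]_(p, n)) (b : 'M[R]_(q, n))
    (c : 'M[R]_(p', n)) (d : 'M[R]_(q', n)) :
  col_mx a b *m B *m (col_mx c d)^T =
  block_mx (a *m B *m c^T) (a *m B *m d^T) (b *m B *m c^T) (b *m B *m d^T).
Proof. by rewrite tr_col_mx mul_col_mx mul_col_row. Qed.

Lemma sylvester_add (W W' : {vspace 'rV[R]_n}) v r s m ep en e0 :
  W = (<[v]> + W')%VS -> (\dim W').+1 = \dim W ->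
  (forall x, x \in W' -> bf B v x = 0) ->
  @sylvester_basis W' r s m ep en e0 ->
  (bf B v v = 1 -> @sylvester_basis W (1 + r) s m (col_mx v ep) en e0) /\
  (bf B v v = -1 -> @sylvester_basis W r (1 + s) m ep (col_mx v en) e0).
Proof.
move=> WE dW vW' [W'E dW' pp nn oo pn po no].
have v0 p (M : 'M[R]_(p, n)) : (rowspan M <= W')%VS -> v *m B *m M^T = 0.
  move=> /subvP MW'; apply: gram_eq0 => x y.
  rewrite rowspan_row => /vlineP[a ->] /MW' yW'.
  by rewrite bfZl vW' ?mulr0.
have vp : v *m B *m ep^T = 0 by apply: v0; rewrite W'E -addvA addvSl.
have vn : v *m B *m en^T = 0.
  by apply: v0; rewrite W'E (addvC (rowspan ep)) -addvA addvSl.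
have vo : v *m B *m e0^T = 0 by apply: v0; rewrite W'E addvSr.
have vv c : bf B v v = c -> v *m B *m v^T = c%:M.
  by move=> <-; rewrite [LHS]mx11_scalar.
split=> vc; split.
- by rewrite rowspan_col rowspan_row WE W'E !addvA.
- by rewrite -dW -dW'.
- by rewrite gram_col (vv _ vc) vp (gram_tr0 vp) pp -scalar_mx_block.
- by [].
- by [].
- by rewrite 2!mul_col_mx vn pn col_mx0.
- by rewrite 2!mul_col_mx vo po col_mx0.
- by [].
- by rewrite rowspan_col rowspan_row WE W'E !addvA (addvC <[v]>%VS).
- by rewrite -dW -dW'; lia.
- by [].
- rewrite gram_col (vv _ vc) vn (gram_tr0 vn) nn.
  rewrite [in RHS](@scalar_mx_block _ 1 s) opp_block_mx !oppr0.
  by rewrite -[(-1)%:M]scalemx1 scaleN1r.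
- by [].
- by rewrite tr_col_mx mul_mx_row (gram_tr0 vp) pn row_mx0.
- by [].
- by rewrite 2!mul_col_mx vo no col_mx0.
Qed.

(** Gram-Schmidt: as long as some v has b(v, v) <> 0, normalize it to
    b(v, v) = 1 or -1 and continue in its orthogonal; when none is left, the
    remaining space is isotropic. *)
Lemma exists_sylvester W : exists r s m ep en e0,
  @sylvester_basis W r s m ep en e0.
Proof.
move: {2}(\dim W) (erefl (\dim W)) => k; elim: k W => [|k IH] W dW.
all: have [[v [vW v0]]|h] := pselect (exists v, v \in W /\ bf B v v != 0).
- by have [W' [_]] := split_off vW v0; rewrite dW.
- have [|e0 he0] := @isotropic_basis W.
    by move=> v vW; apply/eqP/negPn/negP => v0; apply: h; exists v.
  by exists 0%N, 0%N, (\dim W), 0, 0, e0.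
- pose a := (Num.sqrt `|bf B v v|)^-1; pose w := a *: v.
  have a2 : a ^+ 2 = `|bf B v v|^-1 by rewrite exprVn sqr_sqrtr.
  have ww : bf B w w = bf B v v / `|bf B v v|.
    by rewrite bfZl bfZr mulrA -expr2 a2 mulrC.
  have ww1 : bf B w w = 1 \/ bf B w w = -1.
    rewrite ww; case: (ltgtP (bf B v v) 0) v0 => // c _; [right|left].
      by rewrite ltr0_norm // invrN mulrN divff // lt_eqF.
    by rewrite gtr0_norm // divff // gt_eqF.
  have wW : w \in W by rewrite memvZ.
  have [|W' [WE W'd wW']] := split_off wW.
    by case: ww1 => ->; rewrite ?oppr_eq0 oner_neq0.
  have [|r [s [m [ep [en [e0 hs]]]]]] := IH W'; first by lia.
  have [h1 h2] := sylvester_add WE W'd wW' hs.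
  case: ww1 => [/h1 ?|/h2 ?].
    by exists (1 + r)%N, s, m, (col_mx w ep), en, e0.
  by exists r, (1 + s)%N, m, ep, (col_mx w en), e0.
- have [|e0 he0] := @isotropic_basis W.
    by move=> v vW; apply/eqP/negPn/negP => v0; apply: h; exists v.
  by exists 0%N, 0%N, (\dim W), 0, 0, e0.
Qed.
End sylvester.

Lemma gram_row_free (R : realType) n (B : 'M[R]_n) r (e : 'M[R]_(r, n)) G :
  e *m B *m e^T = G -> G \in unitmx -> row_free e.
Proof.
move=> eG Gu; apply/row_free_kerP => u ue.
by rewrite -(mulmxK Gu u) -eG !mulmxA ue !mul0mx.
Qed.

(** The span of the positive vectors is positive definite, that of all the other
    ones nonpositive.  Exchanging ep and en treats - B in the same way. *)
Lemma sylvester_pos_split (R : realType) n (B : 'M[R]_n) W r s m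
    (ep : 'M[R]_(r, n)) (en : 'M[R]_(s, n)) (e0 : 'M[R]_(m, n)) :
  W = (rowspan ep + (rowspan en + rowspan e0))%VS ->
  ep *m B *m ep^T = 1%:M -> en *m B *m en^T = - 1%:M -> e0 *m B *m e0^T = 0 ->
  en *m B *m e0^T = 0 -> e0 *m B *m en^T = 0 ->
  pos_split B W r.
Proof.
move=> WE pp nn oo no on.
have fp : row_free ep by apply: gram_row_free pp (unitmx1 _ _).
have hP : posdef_on (bf B) (rowspan ep).
  move=> _ /memv_rowspan[u ->] u0; rewrite bf_mul pp bf1_gt0 //.
  by apply: contraNneq u0 => ->; rewrite mul0mx.
have hN : nonpos_on (bf B) (rowspan en + rowspan e0)%VS.
  apply: nonpos_add => [_ _ /memv_rowspan[u ->] /memv_rowspan[v ->]|x|x].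
  - by rewrite !bf_mul0.
  - move=> /memv_rowspan[u ->]; rewrite bf_mul nn bfN oppr_le0.
    by rewrite bf1 sumr_ge0 // => j _; apply: sqr_ge0.
  - by move=> /memv_rowspan[u ->]; rewrite bf_mul oo /bf mulmx0 mul0mx mxE.
exists (rowspan ep), (rowspan en + rowspan e0)%VS; split => //.
- by rewrite WE addvSl addvSr.
- exact: dim_rowspan.
apply/eqP; rewrite eqn_leq; apply/andP; split.
  by apply: posdef_nonpos_dim hP hN; rewrite WE ?addvSl ?addvSr.
by rewrite WE dimv_add_leqif.
Qed.

Lemma sylvester_sig_split (R : realType) n (B : 'M[R]_n) (sB : B^T = B) W r s m
    (ep : 'M[R]_(r, n)) (en : 'M[R]_(s, n)) (e0 : 'M[R]_(m, n)) :
  sylvester_basis B W ep en e0 -> sig_split B W r s.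
Proof.
case=> WE _ pp nn oo pn po no; split.
  apply: (sylvester_pos_split _ pp nn oo no); first by rewrite WE addvA.
  exact: (gram_tr0 sB no).
apply: (@sylvester_pos_split _ _ _ _ _ _ _ en ep e0).
- by rewrite WE addvA (addvC (rowspan en)).
- by rewrite mulmxN mulNmx nn opprK.
- by rewrite mulmxN mulNmx pp.
- by rewrite mulmxN mulNmx oo oppr0.
- by rewrite mulmxN mulNmx po oppr0.
- by rewrite mulmxN mulNmx (gram_tr0 sB po) oppr0.
Qed.

Lemma exists_sig_split (R : realType) n (B : 'M[R]_n) (sB : B^T = B) W :
  exists r s, sig_split B W r s.
Proof.
have [r [s [m [ep [en [e0 h]]]]]] := exists_sylvester sB W.
by exists r, s; apply: sylvester_sig_split h.
Qed.

(** With N = G - 1, the bound |u_i u_j| <= (u_i ^ 2 + u_j ^ 2) / 2 gives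
    |N(u, u)| <= eps * r * |u| ^ 2, which is less than |u| ^ 2. *)
Lemma posdef_near_id (R : realType) r (G : 'M[R]_r) (eps : R) :
  eps * r%:R < 1 -> (forall i j, `|(G - 1%:M) i j| <= eps) ->
  forall u, u != 0 -> 0 < bf G u u.
Proof.
move=> er h u u0; set N := G - 1%:M in h.
have -> : bf G u u = bf 1%:M u u + bf N u u.
  by rewrite -bfDm /N addrC subrK.
have := bf1_gt0 u0; rewrite bf1; set S := \sum_j _ => S0.
suff : `|bf N u u| <= eps * r%:R * S.
  have : eps * r%:R * S < S by rewrite gtr_pMl.
  by have := ler_norm (- bf N u u); rewrite normrN; lra.
have -> : bf N u u = \sum_j \sum_i u 0 i * N i j * u 0 j.
  by rewrite /bf mxE; apply: eq_bigr => j _; rewrite !mxE mulr_suml.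
apply: (@le_trans _ _ (\sum_j \sum_i eps * ((u 0 i ^+ 2 + u 0 j ^+ 2) / 2))).
  apply: le_trans (ler_norm_sum _ _ _) _; apply: ler_sum => j _.
  apply: le_trans (ler_norm_sum _ _ _) _; apply: ler_sum => i _.
  rewrite !normrM mulrAC (mulrC _ `|N i j|).
  apply: ler_pM => //.
  rewrite -(real_normK (num_real (u 0 i))) -(real_normK (num_real (u 0 j))).
  by have := sqr_ge0 (`|u 0 i| - `|u 0 j|); rewrite sqrrB; lra.
rewrite (eq_bigr (fun j => eps / 2 * (S + r%:R * u 0 j ^+ 2))); last first.
  move=> j _; rewrite -mulr_sumr -mulr_suml big_split /= sumr_const card_ord.
  by rewrite -/S -mulr_natl; field.
rewrite -mulr_sumr big_split /= sumr_const card_ord -mulr_sumr -/S -mulr_natl.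
by rewrite le_eqVlt; apply/orP; left; apply/eqP; field.
Qed.

Lemma bf_gt0_row_free (R : realType) n (B : 'M[R]_n) r (a : 'M[R]_(r, n)) :
  (forall u, u != 0 -> 0 < bf (a *m B *m a^T) u u) ->
  row_free a /\ posdef_on (bf B) (rowspan a).
Proof.
move=> h; split.
  apply/row_free_kerP => u ua; apply/eqP/negPn/negP => /h.
  by rewrite -bf_mul ua bf0l ltxx.
move=> _ /memv_rowspan[u ->] u0; rewrite bf_mul; apply: h.
by apply: contraNneq u0 => ->; rewrite mul0mx.
Qed.

Lemma le_entry_norm (R : realType) m n (M : 'M[R]_(m, n)) i j :
  `|M i j| <= `|M|.
Proof.
rewrite [leRHS]/Num.Def.normr/= mx_normrE.
exact: (le_bigmax _ (fun p : 'I_m * 'I_n => `|M p.1 p.2|) (i, j)).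
Qed.

Lemma dim_row_free (R : realType) m n (M : 'M[R]_(m, n)) :
  \dim (rowspan M) = m -> row_free M.
Proof.
move=> h; have : (m <= \rank M)%N; last by rewrite -row_leq_rank.
have e : rowspan M = rowspan (row_base M).
  apply/eqP; rewrite eqEsubv; apply/andP.
  by split; apply/rowspan_le/submxP; rewrite eq_row_base.
by rewrite -{1}h e (dim_rowspan (row_base_free _)).
Qed.

Definition sgn_mx (R : realType) r s : 'M[R]_(r + s) :=
  block_mx 1%:M 0 0 (- 1%:M).

Lemma sgn_mx_unit (R : realType) r s : sgn_mx R r s \in unitmx.
Proof.
rewrite unitmxE det_lblock det1 mul1r -scaleN1r detZ det1 mulr1.
by rewrite unitrX // unitrN1.
Qed.

(** Any radius whose product with both r and s is below 1 keeps the diagonal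
    blocks of a perturbation of [sgn_mx] definite, by [posdef_near_id]. *)
Definition sgn_radius (R : realType) (r s : nat) : R := (r + s).+1%:R^-1.

(** Only the two diagonal blocks matter: one makes the first r rows span a
    positive definite space, the other makes the last s rows span a negative
    definite one, and these two spaces certify each other's maximality. *)
Lemma near_sgn_mx (R : realType) n (B : 'M[R]_n) r s (M : 'M[R]_(r + s, n)) :
  `|M *m B *m M^T - sgn_mx R r s| < sgn_radius R r s ->
  row_free M /\ sig_split B (rowspan M) r s.
Proof.
rewrite -[M]vsubmxK; set a := usubmx M; set c := dsubmx M.
rewrite gram_col /sgn_mx opp_block_mx add_block_mx opprK !oppr0 !addr0.
set eps := sgn_radius R r s => h.
have eps_lt t : (t <= r + s)%N -> eps * t%:R < 1.
  by move=> tr; rewrite mulrC ltr_pdivrMr ?ltr0n // mul1r ltr_nat ltnS.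
have [fa Pa] : row_free a /\ posdef_on (bf B) (rowspan a).
  apply: bf_gt0_row_free; apply: (posdef_near_id (eps_lt r (leq_addr _ _))).
  move=> i j; apply: le_trans (ltW h).
  rewrite -(block_mxEul (a *m B *m a^T - 1%:M) (a *m B *m c^T)
    (c *m B *m a^T) (c *m B *m c^T + 1%:M) i j).
  exact: le_entry_norm.
have [fc Pc] : row_free c /\ posdef_on (bf (- B)) (rowspan c).
  apply: bf_gt0_row_free; apply: (posdef_near_id (eps_lt s (leq_addl _ _))).
  move=> i j; apply: le_trans (ltW h).
  rewrite mulmxN mulNmx -opprD [X in `|X|]mxE normrN.
  rewrite -(block_mxEdr (a *m B *m a^T - 1%:M) (a *m B *m c^T)
    (c *m B *m a^T) (c *m B *m c^T + 1%:M) i j).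
  exact: le_entry_norm.
have np C N : posdef_on (bf C) N -> nonpos_on (bf (- C)) N.
  move=> hN x xN; rewrite bfN oppr_le0; have [->|x0] := eqVneq x 0.
    by rewrite bf0l.
  by apply/ltW/hN.
have Nc : nonpos_on (bf B) (rowspan c) by rewrite -(opprK B); apply: np.
have dac : (\dim (rowspan a) + \dim (rowspan c) = \dim (rowspan (col_mx a c)))%N.
  apply/eqP; rewrite rowspan_col eqn_leq dimv_add_leqif andbT.
  by apply: (posdef_nonpos_dim _ _ Pa Nc); rewrite ?addvSl ?addvSr.
have sub : (rowspan a <= rowspan (col_mx a c))%VS /\
    (rowspan c <= rowspan (col_mx a c))%VS.
  by rewrite rowspan_col addvSl addvSr.
split; last split.
- by apply: dim_row_free; rewrite -dac !dim_rowspan.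
- by exists (rowspan a), (rowspan c); split=> //; apply: dim_rowspan.
- exists (rowspan c), (rowspan a); split=> //; first by case: sub.
  + exact: np.
  + exact: dim_rowspan.
  + by rewrite addnC.
Qed.

(** Additivity of inertia: subtracting from the rows of M2 the combination of the
    rows of M1 with coefficients Q^T P^-1 makes them orthogonal to M1 without
    changing the total span, and turns their Gram matrix into the Schur
    complement. *)
Lemma schur_split (R : realType) n (B : 'M[R]_n) t m (M1 : 'M[R]_(t, n))
    (M2 : 'M[R]_(m, n)) r s a c (P := M1 *m B *m M1^T) (Q := M1 *m B *m M2^T) :
  B^T = B -> P \in unitmx -> row_free (col_mx M1 M2) ->
  sig_split B (rowspan M1) r s ->
  sig_split (M2 *m B *m M2^T - Q^T *m invmx P *m Q) fullv a c ->
  sig_split B (rowspan (col_mx M1 M2)) (r + a) (s + c).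
Proof.
move=> sB Pu fM.
have sP : (invmx P)^T = invmx P by rewrite trmx_inv /P !trmx_mul trmxK sB mulmxA.
have QT : Q^T = M2 *m B *m M1^T by rewrite /Q !trmx_mul trmxK sB mulmxA.
pose C := Q^T *m invmx P; pose N := M2 - C *m M1.
have NM1 : N *m B *m M1^T = 0.
  by rewrite !mulmxBl -QT -!mulmxA (mulmxA M1) -/P mulVmx // mulmx1 subrr.
have M1N : M1 *m B *m N^T = 0 by apply: gram_tr0.
have -> : M2 *m B *m M2^T - C *m Q = N *m B *m N^T.
  rewrite [in RHS]/N linearB /= mulmxBr [(C *m M1)^T]trmx_mul.
  rewrite (mulmxA (N *m B)) NM1 mul0mx subr0.
  by rewrite !mulmxBl /Q -!mulmxA.
have fN : row_free N.
  apply/row_free_kerP => u uN; have /row_free_kerP := fM.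
  move=> /(_ (row_mx (- (u *m C)) u)).
  rewrite mul_row_col mulNmx -mulmxA addrC -mulmxBr => /(_ uN).
  by rewrite -[0 in RHS]row_mx0 => /eq_row_mx[].
have -> : rowspan (col_mx M1 M2) = (rowspan M1 + rowspan N)%VS.
  rewrite -rowspan_col -(@rowspan_mul _ _ _ (block_mx 1%:M 0 (- C) 1%:M)).
    by rewrite mul_block_col !mul1mx mul0mx addr0 mulNmx addrC.
  by rewrite unitmxE det_lblock !det1 mulr1 unitr1.
have o x y : x \in rowspan M1 -> y \in rowspan N -> bf B x y = 0 /\ bf B y x = 0.
  by move=> /memv_rowspan[u ->] /memv_rowspan[v ->]; rewrite !bf_mul0.
have d0 : (rowspan M1 :&: rowspan N)%VS = 0%VS.
  apply/eqP; rewrite -subv0; apply/subvP => x; rewrite memv_cap memv0.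
  case/andP=> /memv_rowspan[u ->] /memv_rowspan[v e].
  suff -> : u = 0 by rewrite mul0mx.
  have uP : u *m P = 0 by rewrite /P !mulmxA e -!mulmxA (mulmxA N) NM1 mulmx0.
  by rewrite -(mulmxK Pu u) uP mul0mx.
move=> [p1 n1] [p2 n2]; split; apply: pos_split_add => //.
- exact: pos_split_img.
- by move=> x y hx hy; rewrite !bfN; have [-> ->] := o x y hx hy; rewrite oppr0.
- by apply: pos_split_img => //; rewrite mulmxN mulNmx.
Qed.

(** A form without positive or negative vectors vanishes on the diagonal, hence
    vanishes. *)
Lemma signature00 (R : realType) m (S : 'M[R]_m) : S^T = S ->
  has_signature (bf S) 0 0 <-> S = 0.
Proof.
move=> sS; split=> [[[_ h1] [_ h2]]|->].
  have iso v : bf S v v = 0.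
    have [->|v0] := eqVneq v 0; first by rewrite bf0l.
    case: (ltgtP (bf S v v) 0) => // c.
    - have : (\dim <[v]> <= 0)%N; last by rewrite dim_vline v0.
      apply: h2; split; first exact: subvf.
      move=> _ /vlineP[k ->] k0; rewrite bfZl bfZr mulrA -expr2.
      rewrite pmulr_rlt0 // exprn_even_gt0 //=.
      by apply: contraNneq k0 => ->; rewrite scale0r.
    - have : (\dim <[v]> <= 0)%N; last by rewrite dim_vline v0.
      apply: h1; split; first exact: subvf.
      move=> _ /vlineP[k ->] k0; rewrite bfZl bfZr mulrA -expr2.
      rewrite pmulr_rgt0 // exprn_even_gt0 //=.
      by apply: contraNneq k0 => ->; rewrite scale0r.
  suff : 1%:M *m S *m 1%:M^T = 0 by rewrite trmx1 mulmx1 mul1mx.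
  apply: gram_eq0 => x y _ _; have := iso (x + y).
  by rewrite !(bfDl, bfDr) !iso (bfC y) //; lra.
apply: sig_split_signature; split; exists 0%VS, fullv; split.
all: try by rewrite ?sub0v ?subvf ?dimv0 ?add0n.
all: try by move=> x; rewrite memv0 => ->.
all: by move=> x _; rewrite /bf ?oppr0 mulmx0 mul0mx mxE.
Qed.

(** * Charts of the Grassmannian *)

(** The blocks of the inverse of the matrix with row blocks e and f: right
    multiplication by es and fs reads off the components of a vector along the
    two summands. *)
Record dual_frame (R : realType) i n (e : 'M[R]_(i, n)) (f : 'M[R]_(n - i, n))
    (es : 'M[R]_(n, i)) (fs : 'M[R]_(n, n - i)) : Prop := DualFrame {
  dual_ee : e *m es = 1%:M;
  dual_ef : e *m fs = 0;
  dual_fe : f *m es = 0;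
  dual_ff : f *m fs = 1%:M;
  dual_sum : es *m e + fs *m f = 1%:M }.

Lemma exists_dual_frame (R : realType) i n (e : 'M[R]_(i, n))
    (f : 'M[R]_(n - i, n)) : (i <= n)%N -> row_full (col_mx e f) ->
  exists es fs, dual_frame e f es fs.
Proof.
move=> le_in ef; have /row_fullP[D DC] := ef.
have /row_freeP[D' CD'] : row_free (col_mx e f).
  by rewrite /row_free (eqP ef) subnKC.
have CD : col_mx e f *m D = 1%:M.
  by rewrite -[D]mulmx1 -CD' (mulmxA D) DC mul1mx.
exists (lsubmx D), (rsubmx D); move: DC CD; rewrite -[D]hsubmxK.
rewrite mul_row_col mul_col_row !row_mxKl !row_mxKr => h.
by rewrite scalar_mx_block => /eq_block_mx[].
Qed.

Lemma exists_Gr (R : realType) i n (M : 'M[R]_(i, n)) : row_free M ->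
  exists W : Gr R i n, val W = rowspan M.
Proof.
move=> /dim_rowspan/eqP h.
by exists (exist (fun W : {vspace 'rV[R]_n} => \dim W == i) (rowspan M) h).
Qed.

Lemma Gr_basis (R : realType) i n (W : Gr R i n) :
  exists2 M : 'M[R]_(i, n), val W = rowspan M & row_free M.
Proof. by apply: rowspanK; apply/eqP/(valP W). Qed.

Section chart.
Context (R : realType) (i n : nat) (e : 'M[R]_(i, n)) (f : 'M[R]_(n - i, n)).
Context (es : 'M[R]_(n, i)) (fs : 'M[R]_(n, n - i)) (dual : dual_frame e f es fs).

Lemma graph_es X : (e + X *m f) *m es = 1%:M.
Proof. by rewrite mulmxDl -mulmxA (dual_ee dual) (dual_fe dual) mulmx0 addr0. Qed.

Lemma graph_fs X : (e + X *m f) *m fs = X.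
Proof. by rewrite mulmxDl -mulmxA (dual_ef dual) (dual_ff dual) mulmx1 add0r. Qed.

Lemma frame_decomp m (M : 'M[R]_(m, n)) : M = M *m es *m e + M *m fs *m f.
Proof. by rewrite -!mulmxA -mulmxDr (dual_sum dual) mulmx1. Qed.

Lemma graph_row_free X : row_free (e + X *m f).
Proof.
by apply/row_free_kerP => u h; rewrite -[u]mulmx1 -(graph_es X) mulmxA h mul0mx.
Qed.

(** The projection of W to the span of e along the span of f has matrix M es in
    the basis M; it is invertible exactly when W is transverse to the span of
    f. *)
Lemma Gr_domE (W : Gr R i n) M : val W = rowspan M ->
  cdom (Gr_chart e f) W <-> M *m es \in unitmx.
Proof.
move=> WM; have fM : row_free M by apply: dim_row_free; rewrite -WM; apply/eqP/(valP W).
rewrite /= WM; split=> h.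
  rewrite -row_free_unit; apply/row_free_kerP => u uM.
  have /row_free_kerP := fM; apply.
  apply/eqP; rewrite -memv0 -h memv_cap; apply/andP; split; apply/memv_rowspan.
    by exists u.
  exists (u *m M *m fs).
  by rewrite {1}[u *m M]frame_decomp -[u *m M *m es]mulmxA uM mul0mx add0r.
apply/eqP; rewrite -subv0; apply/subvP => x; rewrite memv_cap memv0.
case/andP=> /memv_rowspan[u ->] /memv_rowspan[v uv].
suff -> : u = 0 by rewrite mul0mx.
by rewrite -(mulmxK h u) mulmxA uv -(mulmxA v) (dual_fe dual) mulmx0 mul0mx.
Qed.

Lemma graph_rowspan M : M *m es \in unitmx ->
  rowspan M = rowspan (e + invmx (M *m es) *m (M *m fs) *m f).
Proof.
move=> Mu; rewrite -[LHS](@rowspan_mul _ _ _ (invmx (M *m es))) ?unitmx_inv //.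
congr rowspan; rewrite {2}[M]frame_decomp mulmxDr.
by rewrite (mulmxA _ (M *m es)) mulVmx // mul1mx !mulmxA.
Qed.

(** This is the source of all transition maps: the coordinates of a subspace are
    a rational function of any of its bases. *)
Lemma Gr_chartE (W : Gr R i n) M : val W = rowspan M -> M *m es \in unitmx ->
  cmap (Gr_chart e f) W = mxvec (invmx (M *m es) *m (M *m fs)).
Proof.
move=> WM Mu /=; congr mxvec.
have ex := graph_rowspan Mu; case: xgetP => [X _ XM|/(_ _) h]; last first.
  by case: (h _ (etrans WM ex)).
have /rowspan_le[A eA] : (rowspan (e + X *m f) <= rowspan M)%VS.
  by rewrite -(etrans (esym WM) XM).
have A1 : A *m (M *m es) = 1%:M by rewrite mulmxA -eA graph_es.
by rewrite -[LHS]graph_fs eA -mulmxA -[A](mulmxK Mu) A1 mul1mx.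
Qed.

Lemma Gr_chart_graph (W : Gr R i n) X : val W = rowspan (e + X *m f) ->
  cdom (Gr_chart e f) W /\ cmap (Gr_chart e f) W = mxvec X.
Proof.
move=> WX; have u : (e + X *m f) *m es \in unitmx by rewrite graph_es unitmx1.
split; first exact/(Gr_domE WX).
by rewrite (Gr_chartE WX u) graph_es graph_fs invmx1 mul1mx.
Qed.

Lemma Gr_chartK (W : Gr R i n) : cdom (Gr_chart e f) W ->
  val W = rowspan (e + vec_mx (cmap (Gr_chart e f) W) *m f).
Proof.
have [M WM _] := Gr_basis W; move=> /(Gr_domE WM) Mu.
by rewrite (Gr_chartE WM Mu) mxvecK -graph_rowspan.
Qed.

Lemma exists_graph X : exists W : Gr R i n, [/\ val W = rowspan (e + X *m f),
  cdom (Gr_chart e f) W & cmap (Gr_chart e f) W = mxvec X].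
Proof.
have [W WX] := exists_Gr (graph_row_free X); exists W.
by have [] := Gr_chart_graph WX.
Qed.
End chart.

#[local] Arguments Gr_chart : simpl never.

(** The part of a graph chart lying over Om, followed by the change of
    coordinates psi. *)
Definition rechart (R : realType) i n d (e : 'M[R]_(i, n))
    (f : 'M[R]_(n - i, n)) (Om : set 'M[R]_(i, n - i))
    (psi : 'M[R]_(i, n - i) -> 'rV[R]_d) : chart R d (Gr R i n) :=
  Chart [set W | cdom (Gr_chart e f) W /\ Om (vec_mx (cmap (Gr_chart e f) W))]
    (fun W => psi (vec_mx (cmap (Gr_chart e f) W))).

(** Smoothness tested on all smooth families.  For the explicit rational maps
    used here this is as easy to prove as smoothness on Om, and it spares a chain
    rule when transition maps are composed. *)
Definition smooth_fun (R : realType) p q r s (Om : set 'M[R]_(p, q))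
    (psi : 'M[R]_(p, q) -> 'M[R]_(r, s)) : Prop :=
  forall (V : normedModType R) (D : set V) (F : V -> 'M[R]_(p, q)), open D ->
    (forall x, D x -> Om (F x)) -> smooth_mx D F ->
    smooth_mx D (fun x => psi (F x)).

Section rechart.
Context (R : realType) (i n : nat) (le_in : (i <= n)%N).
Context (e : 'M[R]_(i, n)) (f : 'M[R]_(n - i, n)) (ef : row_full (col_mx e f)).
Context (Om : set 'M[R]_(i, n - i)) (Om' : set 'rV[R]_(i * (n - i))).
Context (psi : 'M[R]_(i, n - i) -> 'rV[R]_(i * (n - i))).
Context (psi' : 'rV[R]_(i * (n - i)) -> 'M[R]_(i, n - i)).
Hypothesis (oOm : open [set y | Om (vec_mx y)]) (oOm' : open Om').
Hypothesis (psiOm : forall X, Om X -> Om' (psi X)).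
Hypothesis (psiOm' : forall y, Om' y -> Om (psi' y)).
Hypothesis (psiK : forall X, Om X -> psi' (psi X) = X).
Hypothesis (psi'K : forall y, Om' y -> psi (psi' y) = y).
Hypothesis (spsi : smooth_fun Om psi) (spsi' : smooth_fun Om' psi').

Let c := rechart e f Om psi.

Let cmapE W : cmap c W = psi (vec_mx (cmap (Gr_chart e f) W)).
Proof. by []. Qed.

Lemma rechart_image : cmap c @` cdom c = Om'.
Proof.
have [es [fs dual]] := exists_dual_frame le_in ef.
apply/seteqP; split=> [_ [W [_ /psiOm h] <-] //|y Oy].
have [W [_ dW cW]] := exists_graph dual (psi' y).
exists W; last by rewrite cmapE cW mxvecK psi'K.
by split=> //; rewrite cW mxvecK; apply: psiOm'.
Qed.

Section transition.
Context (e' : 'M[R]_(i, n)) (f' : 'M[R]_(n - i, n)) (ef' : row_full (col_mx e' f')).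
Let c' := Gr_chart e' f'.

(** Both transition maps are explicit: T reads the basis e + psi' y f of a
    subspace in the frame (e', f'), and T' reads the basis e' + Y f' in the frame
    (e, f), after which psi is applied. *)
Lemma rechart_compatible : compatible c c'.
Proof.
have [es [fs dual]] := exists_dual_frame le_in ef.
have [es' [fs' dual']] := exists_dual_frame le_in ef'.
pose M y := e + psi' y *m f; pose M' (y : 'rV_(i * (n - i))) := e' + vec_mx y *m f'.
have oT : open [set: 'rV[R]_(i * (n - i))] by exact: openT.
have sM : smooth_mx Om' M.
  apply: smooth_mxD => //; first exact: smooth_mx_cst.
  apply: smooth_mxM => //; last exact: smooth_mx_cst.
  by apply: spsi' => //; apply: smooth_mx_id.
have sM' : smooth_mx setT M'.
  apply: smooth_mxD => //; first exact: smooth_mx_cst.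
  apply: smooth_mxM => //; last exact: smooth_mx_cst.
  by apply: smooth_vec_mx => //; apply: smooth_mx_id.
pose D := [set y | Om' y /\ M y *m es' \in unitmx].
pose D' := [set y | [set: 'rV[R]_(i * (n - i))] y /\ M' y *m es \in unitmx].
have oD : open D.
  by apply: open_det_neq0 => //; apply: smooth_mxM => //; apply: smooth_mx_cst.
have oD' : open D'.
  by apply: open_det_neq0 => //; apply: smooth_mxM => //; apply: smooth_mx_cst.
pose T y := invmx (M y *m es') *m (M y *m fs').
pose T' y := invmx (M' y *m es) *m (M' y *m fs).
have sT : smooth_mx D T.
  have sMD : smooth_mx D M by move=> a b; apply: smooth_on_sub (sM a b) => y [].
  apply: smooth_mxM => //; last by apply: smooth_mxM => //; apply: smooth_mx_cst.
  apply: smooth_invmx => //; first by move=> y [].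
  by apply: smooth_mxM => //; apply: smooth_mx_cst.
have sT' : smooth_mx D' T'.
  have sMD : smooth_mx D' M' by move=> a b; apply: smooth_on_sub (sM' a b) => y [].
  apply: smooth_mxM => //; last by apply: smooth_mxM => //; apply: smooth_mx_cst.
  apply: smooth_invmx => //; first by move=> y [].
  by apply: smooth_mxM => //; apply: smooth_mx_cst.
pose E' := [set y | D' y /\ Om (T' y)].
have oE' : open E'.
  have -> : E' = [set y | D' y /\ [set y | Om (vec_mx y)] (mxvec (T' y))].
    by apply/seteqP; split=> y /=; rewrite mxvecK.
  exact: (open_preimage oD' (smooth_mx_on oD' (smooth_mxvec oD' sT') 0%N) oOm).
have cW W : (cdom c `&` cdom c') W -> D (cmap c W) /\ cmap c' W = mxvec (T (cmap c W)).
  move=> [[dW OW] d'W]; have WX := Gr_chartK dual dW.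
  have WM : val W = rowspan (M (cmap c W)) by rewrite /M psiK.
  have u : M (cmap c W) *m es' \in unitmx by apply/(Gr_domE dual' WM).
  by split; [split=> //; apply: psiOm|rewrite (Gr_chartE dual' WM u)].
have cW' W : (cdom c `&` cdom c') W -> E' (cmap c' W) /\ cmap c W = psi (T' (cmap c' W)).
  move=> [[dW OW] d'W]; have WM : val W = rowspan (M' (cmap c' W)) := Gr_chartK dual' d'W.
  have u : M' (cmap c' W) *m es \in unitmx by apply/(Gr_domE dual WM).
  have e1 := Gr_chartE dual WM u.
  have e2 : vec_mx (cmap (Gr_chart e f) W) = T' (cmap c' W) by rewrite e1 mxvecK.
  by split; [split=> //; rewrite -e2|rewrite -e2].
have iD : cmap c @` (cdom c `&` cdom c') = D.
  apply/seteqP; split=> [_ [W /cW[h _] <-] //|y [Oy uy]].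
  have [W [WX dW cWy]] := exists_graph dual (psi' y).
  exists W; last by rewrite cmapE cWy mxvecK psi'K.
  split; last exact/(Gr_domE dual' WX).
  by split=> //; rewrite cWy mxvecK; apply: psiOm'.
have iE' : cmap c' @` (cdom c `&` cdom c') = E'.
  apply/seteqP; split=> [_ [W /cW'[h _] <-] //|y [[_ uy] Oy]].
  have [W [WX dW cWy]] := exists_graph dual' (vec_mx y).
  have d := Gr_domE dual WX; have ey := Gr_chartE dual WX uy.
  exists W; last by rewrite cWy vec_mxK.
  by split=> //; split; [exact/d|rewrite ey mxvecK].
split.
- by rewrite iD.
- by rewrite iE'.
- exists (fun y => mxvec (T y)); last by move=> W /cW[].
  by rewrite iD; apply/smooth_mx_on/smooth_mxvec.
- exists (fun y => psi (T' y)); last by move=> W /cW'[].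
  rewrite iE'; apply: smooth_mx_on => //; apply: spsi => //; first by move=> y [].
  by move=> a b; apply: smooth_on_sub (sT' a b) => y [].
Qed.
End transition.

Lemma rechart_inj : {in cdom c &, injective (cmap c)}.
Proof.
have [es [fs dual]] := exists_dual_frame le_in ef.
move=> W W'; rewrite !inE => -[dW OW] [dW' OW'] h.
apply: val_inj; rewrite (Gr_chartK dual dW) (Gr_chartK dual dW').
by rewrite -[vec_mx _]psiK // -[vec_mx (cmap _ W')]psiK //; move: h => /= ->.
Qed.

Lemma rechart_smooth_chart : smooth_chart (Gr_atlas R i n) c.
Proof.
split; first exact: rechart_inj.
  by rewrite rechart_image.
by move=> c' [e' [f' [ef' ->]]]; apply: rechart_compatible.
Qed.

Lemma rechart_mopen : mopen (Gr_atlas R i n) (cdom c).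
Proof.
move=> c' [e' [f' [ef' ->]]].
by have [_ h _ _] := rechart_compatible ef'; rewrite setIC.
Qed.
End rechart.

Lemma smooth_linear (R : realType) (V : normedModType R) (D : set V) p q p' q'
    (h : 'M[R]_(p, q) -> 'M[R]_(p', q')) (F : V -> 'M[R]_(p, q)) :
  open D -> linear h -> smooth_mx D F -> smooth_mx D (fun x => h (F x)).
Proof.
move=> oD lh hF.
pose hL : {linear 'M[R]_(p, q) -> 'M[R]_(p', q')} :=
  HB.pack h (GRing.isLinear.Build _ _ _ _ _ lh).
have e x : D x -> vec_mx (mxvec (F x) *m lin_mx hL) = h (F x).
  by rewrite mul_vec_lin mxvecK.
apply: smooth_mx_ext e _ => //; apply: smooth_vec_mx => //.
by apply: smooth_mxM (smooth_mx_cst _ _) => //; apply: smooth_mxvec.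
Qed.

(** * Frames adapted to the radical and to a submersion *)

(** The complement f of the span of e1, e2 contains the rows of f1, which are dual
    to the rows of e2, and is orthogonal to f1; in particular f1 is isotropic. *)
Record hyperbolic_frame (R : realType) n t m (B : 'M[R]_n) (e1 : 'M[R]_(t, n))
    (e2 f1 : 'M[R]_(m, n)) (f : 'M[R]_(n - (t + m), n)) (L : 'M[R]_(m, n - (t + m))) :
  Prop := HyperbolicFrame {
    hyp_full : row_full (col_mx (col_mx e1 e2) f);
    hyp_f1 : f1 = L *m f;
    hyp_ef : e1 *m B *m f1^T = 0;
    hyp_dual : e2 *m B *m f1^T = 1%:M;
    hyp_ff : f *m B *m f1^T = 0 }.

(** A family dual to e2 and orthogonal to e1 exists because the form is
    nondegenerate, and it can be corrected by combinations of e2 to become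
    isotropic.  The orthogonal of e1 and f1 is then the required complement: it
    contains f1, and it meets the span of e1, e2 trivially since the pairing of
    e1, e2 with e1, f1 is invertible. *)
Lemma exists_hyperbolic_frame (R : realType) n t m (B : 'M[R]_n)
    (e1 : 'M[R]_(t, n)) (e2 : 'M[R]_(m, n)) :
  (t + m <= n)%N -> B^T = B -> B \in unitmx -> e1 *m B *m e1^T \in unitmx ->
  e1 *m B *m e2^T = 0 -> e2 *m B *m e2^T = 0 -> row_free (col_mx e1 e2) ->
  exists f1 f L, hyperbolic_frame B e1 e2 f1 f L.
Proof.
move=> le_n sB Bu Du e12 e22 fE.
have e21 := gram_tr0 sB e12.
have /row_freeP[Z EZ] : row_free (col_mx e1 e2 *m B).
  apply/row_free_kerP => u; rewrite mulmxA => /(congr1 (mulmx^~ (invmx B))).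
  by rewrite mulmxK // mul0mx; apply: (row_free_kerP _).1.
pose g := (rsubmx Z)^T.
have [g1 g2] : e1 *m B *m g^T = 0 /\ e2 *m B *m g^T = 1%:M.
  move: EZ; rewrite -[Z]hsubmxK mul_col_mx mul_col_row /g trmxK.
  by rewrite scalar_mx_block => /eq_block_mx[].
have g2' : g *m B *m e2^T = 1%:M.
  by have := congr1 trmx g2; rewrite !trmx_mul trmxK sB trmx1 mulmxA.
pose K := g *m B *m g^T.
have sK : K^T = K by rewrite /K !trmx_mul trmxK sB mulmxA.
(* As b(e2, g) = 1, the two cross terms cancel the Gram matrix K of g. *)
pose f1 := g - 2^-1 *: (K *m e2).
have f1T : f1^T = g^T - 2^-1 *: (e2^T *m K).
  by rewrite /f1 linearB linearZ /= trmx_mul sK.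
have e1f : e1 *m B *m f1^T = 0.
  by rewrite f1T mulmxBr g1 -scalemxAr mulmxA e12 mul0mx scaler0 subr0.
have e2f : e2 *m B *m f1^T = 1%:M.
  by rewrite f1T mulmxBr g2 -scalemxAr mulmxA e22 mul0mx scaler0 subr0.
have f1f1 : f1 *m B *m f1^T = 0.
  rewrite {1}/f1 !mulmxBl -!scalemxAl -!(mulmxA K) e2f mulmx1.
  rewrite f1T mulmxBr -scalemxAr mulmxA g2' mul1mx -/K.
  by apply/matrixP => a b; rewrite !mxE; field.
pose h := col_mx e1 f1.
have Eh : col_mx e1 e2 *m (B *m h^T) \in unitmx.
  by rewrite mulmxA gram_col e1f e21 e2f unitmxE det_ublock det1 mulr1 -unitmxE.
have rk : \rank (kermx (B *m h^T)) = (n - (t + m))%N.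
  rewrite mxrank_ker; congr (n - _)%N; apply/eqP; rewrite eqn_leq rank_leq_col /=.
  have /eqP {1}<- : row_free (col_mx e1 e2 *m (B *m h^T)) by rewrite row_free_unit.
  exact: mxrankM_maxr.
pose f := castmx (rk, erefl n) (row_base (kermx (B *m h^T))).
have fker : (f :=: kermx (B *m h^T))%MS.
  by apply: eqmx_trans (eq_row_base _); apply: eqmx_cast.
have fBh : f *m (B *m h^T) = 0 by apply/sub_kermxP; rewrite fker.
have /submxP[L f1L] : (f1 <= f)%MS.
  rewrite fker; apply/sub_kermxP.
  by rewrite /h tr_col_mx !mul_mx_row !mulmxA (gram_tr0 sB e1f) f1f1 row_mx0.
have ff : row_free f by rewrite /row_free fker rk.
exists f1, f, L; split=> //; last first.
  move: fBh; rewrite /h tr_col_mx mul_mx_row mul_mx_row -row_mx0.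
  by move=> /eq_row_mx[_ <-]; rewrite mulmxA.
suff : row_free (col_mx (col_mx e1 e2) f).
  by rewrite /row_full /row_free => /eqP ->; rewrite subnKC.
apply/row_free_kerP => u; rewrite -[u]hsubmxK mul_row_col => uv.
have u0 : lsubmx u = 0.
  rewrite -[LHS](mulmxK Eh); have := congr1 (mulmx^~ (B *m h^T)) uv.
  rewrite mulmxDl mul0mx -2!(mulmxA _ _ (B *m h^T)) fBh mulmx0 addr0 => ->.
  by rewrite mul0mx.
move: uv; rewrite u0 mul0mx add0r => /(row_free_kerP _).1 ->; last exact: ff.
by rewrite row_mx0.
Qed.

(** Gaussian elimination A = L D U with L, U invertible and D of full rank N
    makes the kernel of A the vanishing of the first N coordinates of v L;
    slices ask for the last coordinates, so their order is reversed. *)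
Lemma exists_slice_coords (R : realType) d N (A : 'M[R]_(d, N)) : row_full A ->
  exists2 G, G \in unitmx & forall v : 'rV_d, v *m A = 0 <-> slice (d - N) (v *m G).
Proof.
move=> fA; have rA : \rank A = N by apply/eqP.
have Nd : (N <= d)%N by rewrite -rA rank_leq_row.
pose J : 'M[R]_d := \matrix_(a, b) (a == rev_ord b)%:R.
have vJ (v : 'rV_d) b : (v *m J) 0 b = v 0 (rev_ord b).
  rewrite mxE (bigD1 (rev_ord b)) //= mxE eqxx mulr1 big1 ?addr0 // => a ab.
  by rewrite mxE (negbTE ab) mulr0.
have JJ : J *m J = 1%:M.
  apply/row_matrixP => a; rewrite row_mul row1; apply/rowP => b.
  by rewrite vJ !mxE rev_ordK eqxx eq_sym.
exists (col_ebase A *m J).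
  by rewrite unitmx_mul col_ebase_unit; case/mulmx1_unit: JJ.
move=> v; rewrite -{1}(mulmx_ebase A) rA !mulmxA; set w := v *m col_ebase A.
have -> : w *m pid_mx N *m row_ebase A = 0 <-> w *m (pid_mx N : 'M[R]_(d, N)) = 0.
  split=> [h|->]; last by rewrite mul0mx.
  by rewrite -[LHS](mulmxK (row_ebase_unit A)) h mul0mx.
have wpid (j : 'I_N) : (w *m (pid_mx N : 'M[R]_(d, N))) 0 j = w 0 (widen_ord Nd j).
  rewrite mxE (bigD1 (widen_ord Nd j)) // [pid_mx _ _ _]mxE /= eqxx ltn_ord mulr1.
  rewrite big1 ?addr0 // => a ab; rewrite [pid_mx _ _ _]mxE.
  have /negbTE -> : (a : nat) != j by apply: contraNneq ab => aj; apply/eqP/val_inj.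
  by rewrite mulr0.
split=> [h j dj|h].
  have jN : (rev_ord j < N)%N by rewrite /=; have := ltn_ord j; lia.
  rewrite vJ -[rev_ord j](_ : widen_ord Nd (Ordinal jN) = _); last exact: val_inj.
  by rewrite -wpid h mxE.
apply/rowP => j; rewrite wpid [RHS]mxE -[widen_ord _ _]rev_ordK -vJ h //=.
by have := ltn_ord j; lia.
Qed.

Lemma slice_pid (R : realType) d k (kd : (k <= d)%N) (y : 'rV[R]_d) :
  slice k y -> y *m (pid_mx k : 'M[R]_(d, k)) *m (pid_mx k : 'M[R]_(k, d)) = y.
Proof.
move=> sy; rewrite -mulmxA mul_pid_mx !minnn.
apply/rowP => j; rewrite mxE (bigD1 j) //= big1 ?addr0 => [|a aj].
  rewrite mxE eqxx /=; case: ltnP => [_|kj]; first by rewrite mulr1.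
  by rewrite sy // mul0r.
by rewrite mxE -val_eqE in aj *; rewrite (negbTE aj) mulr0.
Qed.

Lemma pid_slice (R : realType) d k (kd : (k <= d)%N) (a : 'rV[R]_k) :
  slice k (a *m (pid_mx k : 'M[R]_(k, d))) /\
  a *m (pid_mx k : 'M[R]_(k, d)) *m (pid_mx k : 'M[R]_(d, k)) = a.
Proof.
split=> [j kj|]; last first.
  by rewrite -mulmxA mul_pid_mx !minnn (minn_idPr kd) pid_mx_1 mulmx1.
rewrite mxE big1 // => l _; rewrite mxE.
have /negbTE -> : (l : nat) != j by have := ltn_ord l; lia.
by rewrite mulr0.
Qed.

(** * The Schur complement as a submersion in normal form *)

Section schur.
Context (R : realType) (n r s m : nat) (B : 'M[R]_n).
Context (e1 : 'M[R]_(r + s, n)) (e2 f1 : 'M[R]_(m, n)).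
Context (f : 'M[R]_(n - (r + s + m), n)) (L : 'M[R]_(m, n - (r + s + m))).
Hypothesis (le_n : (r + s + m <= n)%N) (sB : B^T = B).
Hypothesis (H : hyperbolic_frame B e1 e2 f1 f L).
Hypothesis (e11 : e1 *m B *m e1^T = sgn_mx R r s).

Implicit Types (X Y : 'M[R]_(r + s + m, n - (r + s + m))) (tau : 'M[R]_m).

(** [graph1] and [graph2] are the basis vectors of the graph of X lying over e1
    and e2; [gramP], [gramQ] and [gramS] are the blocks of their Gram matrix. *)
Definition graph1 X := e1 + usubmx X *m f.
Definition graph2 X := e2 + dsubmx X *m f.
Definition gramP X := graph1 X *m B *m (graph1 X)^T.
Definition gramQ X := graph1 X *m B *m (graph2 X)^T.
Definition gramS X := graph2 X *m B *m (graph2 X)^T.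
Definition schur X := gramS X - (gramQ X)^T *m invmx (gramP X) *m gramQ X.

(** The displacement of a graph that adds tau f1 / 2 to [graph2].  Since f1 is
    dual to e2, the two cross terms contribute tau / 2 each to [gramS] when tau is
    symmetric. *)
Definition sym_push tau : 'M[R]_(r + s + m, n - (r + s + m)) :=
  col_mx 0 (2^-1 *: (tau *m L)).

(** The differential of [schur] at 0.  It is used as a linear map whose kernel is
    to model the zero set of [schur]; what matters is that both react to
    [sym_push] in the same way. *)
Definition lin_schur X : 'M[R]_m :=
  dsubmx X *m (f *m B *m e2^T) + (dsubmx X *m (f *m B *m e2^T))^T.

(** The open condition under which the block P keeps the signature (r, s) and
    [schur] is defined.  It involves [graph1] only, so it is invariant under
    [sym_push]. *)
Definition regular X : Prop :=
  gramP X \in unitmx /\ `|gramP X - sgn_mx R r s| < sgn_radius R r s.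

Lemma graph_col X : col_mx e1 e2 + X *m f = col_mx (graph1 X) (graph2 X).
Proof. by rewrite -{1}[X]vsubmxK mul_col_mx add_col_mx. Qed.

Lemma graph1_push X tau : graph1 (X + sym_push tau) = graph1 X.
Proof. by rewrite /graph1 /sym_push linearD /= col_mxKu addr0. Qed.

Lemma graph2_push X tau :
  graph2 (X + sym_push tau) = graph2 X + 2^-1 *: (tau *m f1).
Proof.
rewrite /graph2 /sym_push linearD /= col_mxKd mulmxDl addrA -scalemxAl.
by rewrite -mulmxA -(hyp_f1 H).
Qed.

Lemma gramP_push X tau : gramP (X + sym_push tau) = gramP X.
Proof. by rewrite /gramP graph1_push. Qed.

Lemma regular_push X tau : regular (X + sym_push tau) <-> regular X.
Proof. by rewrite /regular gramP_push. Qed.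

Lemma graph1_f1 X : graph1 X *m B *m f1^T = 0.
Proof. by rewrite !mulmxDl (hyp_ef H) -!mulmxA !(mulmxA f) (hyp_ff H) mulmx0 addr0. Qed.

Lemma graph2_f1 X : graph2 X *m B *m f1^T = 1%:M.
Proof. by rewrite !mulmxDl (hyp_dual H) -!mulmxA !(mulmxA f) (hyp_ff H) mulmx0 addr0. Qed.

Lemma f1_f1 : f1 *m B *m f1^T = 0.
Proof. by rewrite {1}(hyp_f1 H) -!mulmxA !(mulmxA f) (hyp_ff H) mulmx0. Qed.

Lemma f1_graph2 X : f1 *m B *m (graph2 X)^T = 1%:M.
Proof.
by have := congr1 trmx (graph2_f1 X); rewrite !trmx_mul trmxK sB trmx1 mulmxA.
Qed.

Lemma gramQ_push X tau : gramQ (X + sym_push tau) = gramQ X.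
Proof.
rewrite /gramQ graph1_push graph2_push linearD /= linearZ /= trmx_mul.
by rewrite mulmxDr -scalemxAr mulmxA graph1_f1 mul0mx scaler0 addr0.
Qed.

Lemma gramS_push X tau : tau^T = tau -> gramS (X + sym_push tau) = gramS X + tau.
Proof.
move=> st; rewrite /gramS graph2_push linearD /= linearZ /= trmx_mul st.
move: (graph2 X) (graph2_f1 X) (f1_graph2 X) => g gf fg.
rewrite !mulmxDl !mulmxDr -!scalemxAr -!scalemxAl.
have -> : g *m B *m (f1^T *m tau) = tau by rewrite mulmxA gf mul1mx.
have -> : tau *m f1 *m B *m g^T = tau.
  by rewrite -!mulmxA (mulmxA f1) fg mulmx1.
have -> : tau *m f1 *m B *m (f1^T *m tau) = 0.
  by rewrite -!mulmxA (mulmxA f1) (mulmxA (f1 *m B)) f1_f1 mul0mx mulmx0.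
rewrite !scaler0 addr0 -addrA -scalerDl; congr (_ + _).
by rewrite -[RHS]scale1r; congr (_ *: _); field.
Qed.

(** The key identity: [schur] restricted to the orbits of [sym_push] is a
    translation. *)
Lemma schur_push X tau : tau^T = tau -> schur (X + sym_push tau) = schur X + tau.
Proof.
by move=> st; rewrite /schur gramP_push gramQ_push gramS_push // addrAC.
Qed.

Lemma lin_schur_push X tau : tau^T = tau ->
  lin_schur (X + sym_push tau) = lin_schur X + tau.
Proof.
move=> st; rewrite /lin_schur linearD /= /sym_push col_mxKd mulmxDl.
have -> : 2^-1 *: (tau *m L) *m (f *m B *m e2^T) = 2^-1 *: tau.
  rewrite -scalemxAl -(mulmxA tau) !(mulmxA L) -(hyp_f1 H).
  have -> : f1 *m B *m e2^T = 1%:M.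
    by have := congr1 trmx (hyp_dual H); rewrite !trmx_mul trmxK sB trmx1 mulmxA.
  by rewrite mulmx1.
rewrite linearD /= linearZ /= st addrACA; congr (_ + _).
by rewrite -scalerDl -[RHS]scale1r; congr (_ *: _); field.
Qed.

Lemma lin_schur_sym X : (lin_schur X)^T = lin_schur X.
Proof. by rewrite /lin_schur linearD /= trmxK addrC. Qed.

Lemma schur_sym X : (schur X)^T = schur X.
Proof.
have sym p (M : 'M[R]_(p, n)) : (M *m B *m M^T)^T = M *m B *m M^T.
  by rewrite !trmx_mul trmxK sB mulmxA.
have sS : (gramS X)^T = gramS X by exact: sym.
have sP : (gramP X)^T = gramP X by exact: sym.
rewrite /schur linearB /= sS; congr (_ - _); move: (gramQ X) => Q.
by rewrite !trmx_mul trmxK trmx_inv sP mulmxA.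
Qed.

Lemma sym_push_linear : linear sym_push.
Proof.
move=> a x y; rewrite /sym_push scale_col_mx add_col_mx scaler0 addr0.
by congr col_mx; rewrite mulmxDl scalerDr -scalemxAl !scalerA (mulrC a).
Qed.

Lemma sym_pushD x y : sym_push (x + y) = sym_push x + sym_push y.
Proof. by have := sym_push_linear 1 x y; rewrite !scale1r. Qed.

Lemma sym_push0 : sym_push 0 = 0.
Proof. by rewrite /sym_push mul0mx scaler0 col_mx0. Qed.

Lemma sym_pushN x : sym_push (- x) = - sym_push x.
Proof. by apply/eqP; rewrite -addr_eq0 -sym_pushD addNr sym_push0. Qed.

Lemma lin_schur_linear : linear lin_schur.
Proof.
move=> a x y; rewrite /lin_schur linearD /= linearZ /= mulmxDl linearD /=.
by rewrite -!scalemxAl linearZ /= scalerDr addrACA.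
Qed.

Lemma lin_schur0 : lin_schur 0 = 0.
Proof. by rewrite /lin_schur linear0 mul0mx trmx0 addr0. Qed.

(** The difference of [schur] and [lin_schur] is constant along [sym_push], so
    that pushing by it is undone by pushing by its opposite, and [lin_schur] takes
    at the sheared point the value of [schur] at the original one. *)
Definition shear X := X + sym_push (schur X - lin_schur X).
Definition unshear X := X - sym_push (schur X - lin_schur X).

Let defect_sym X : (schur X - lin_schur X)^T = schur X - lin_schur X.
Proof. by rewrite linearB /= schur_sym lin_schur_sym. Qed.

Let defect_push X tau : tau^T = tau ->
  schur (X + sym_push tau) - lin_schur (X + sym_push tau) = schur X - lin_schur X.
Proof.
by move=> st; rewrite schur_push // lin_schur_push // opprD addrACA subrr addr0.
Qed.

Lemma shearK : cancel shear unshear.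
Proof. by move=> X; rewrite /unshear {2 3}/shear defect_push // addrK. Qed.

Lemma unshearK : cancel unshear shear.
Proof.
move=> X; have e : unshear X = X + sym_push (- (schur X - lin_schur X)).
  by rewrite sym_pushN.
by rewrite /shear e defect_push ?linearN /= ?defect_sym // sym_pushN subrK.
Qed.

Lemma regular_shear X : regular (shear X) <-> regular X.
Proof. exact: regular_push. Qed.

Lemma regular_unshear X : regular (unshear X) <-> regular X.
Proof. by rewrite /unshear -sym_pushN; apply: regular_push. Qed.

Lemma lin_schur_shear X : lin_schur (shear X) = schur X.
Proof. by rewrite lin_schur_push // addrC subrK. Qed.

Lemma regular0 : regular 0.
Proof.
rewrite /regular /gramP /graph1 linear0 mul0mx addr0 e11 subrr normr0.
by split; [exact: sgn_mx_unit|rewrite /sgn_radius invr_gt0 ltr0n].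
Qed.

Lemma schur_sig X a c : regular X -> sig_split (schur X) fullv a c ->
  sig_split B (rowspan (col_mx e1 e2 + X *m f)) (r + a) (s + c).
Proof.
move=> [Pu Pd] h; have [_ h1] := near_sgn_mx Pd.
have [es [fs dual]] := exists_dual_frame le_n (hyp_full H).
have := graph_row_free dual X; rewrite graph_col => fr.
exact: schur_split.
Qed.

Section smoothness.
Context (V : normedModType R) (D : set V) (oD : open D).
Context (F : V -> 'M[R]_(r + s + m, n - (r + s + m))) (hF : smooth_mx D F).

Lemma smooth_graph1 : smooth_mx D (fun x => graph1 (F x)).
Proof.
rewrite /graph1; apply: (smooth_mxD oD (smooth_mx_cst D _)).
apply: (smooth_mxM oD _ (smooth_mx_cst D _)).
by apply: (smooth_linear oD _ hF) => a x y; rewrite linearD linearZ.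
Qed.

Lemma smooth_graph2 : smooth_mx D (fun x => graph2 (F x)).
Proof.
rewrite /graph2; apply: (smooth_mxD oD (smooth_mx_cst D _)).
apply: (smooth_mxM oD _ (smooth_mx_cst D _)).
by apply: (smooth_linear oD _ hF) => a x y; rewrite linearD linearZ.
Qed.

Lemma smooth_gram p q (G : V -> 'M[R]_(p, n)) (K : V -> 'M[R]_(q, n)) :
  smooth_mx D G -> smooth_mx D K ->
  smooth_mx D (fun x => G x *m B *m (K x)^T).
Proof.
move=> hG hK; apply: (smooth_mxM oD _ (smooth_trmx oD hK)).
exact: (smooth_mxM oD hG (smooth_mx_cst D _)).
Qed.

Lemma smooth_gramP : smooth_mx D (fun x => gramP (F x)).
Proof. by apply: smooth_gram; apply: smooth_graph1. Qed.

Lemma smooth_schur : (forall x, D x -> regular (F x)) ->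
  smooth_mx D (fun x => schur (F x)).
Proof.
move=> hreg; rewrite /schur.
have sQ : smooth_mx D (fun x => gramQ (F x)).
  by apply: smooth_gram; [apply: smooth_graph1|apply: smooth_graph2].
apply: (smooth_mxB oD); first by apply: smooth_gram; apply: smooth_graph2.
apply: (smooth_mxM oD _ sQ); apply: (smooth_mxM oD (smooth_trmx oD sQ)).
apply: (smooth_invmx oD _ smooth_gramP) => x Dx.
by have [] := hreg x Dx.
Qed.

Lemma smooth_defect : (forall x, D x -> regular (F x)) ->
  smooth_mx D (fun x => sym_push (schur (F x) - lin_schur (F x))).
Proof.
move=> hreg; have hl := smooth_linear oD lin_schur_linear hF.
have hs := smooth_mxB oD (smooth_schur hreg) hl.
exact: (smooth_linear oD sym_push_linear hs).
Qed.

Lemma smooth_shear : (forall x, D x -> regular (F x)) ->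
  smooth_mx D (fun x => shear (F x)).
Proof.
by move=> hreg; rewrite /shear; apply: (smooth_mxD oD hF); apply: smooth_defect.
Qed.

Lemma smooth_unshear : (forall x, D x -> regular (F x)) ->
  smooth_mx D (fun x => unshear (F x)).
Proof.
by move=> hreg; rewrite /unshear; apply: (smooth_mxB oD hF); apply: smooth_defect.
Qed.

(** Invertibility of P is an open condition, and so is the bound on its distance
    to [sgn_mx]. *)
Lemma open_regular : open [set x | D x /\ regular (F x)].
Proof.
pose D' := [set x | D x /\ gramP (F x) \in unitmx].
have oD' : open D' by apply: (open_det_neq0 oD smooth_gramP).
have sP : smooth_mx D' (fun x => gramP (F x)).
  by move=> a b; apply: smooth_on_sub (smooth_gramP a b) => x [].
have hP := smooth_mx_on oD' (smooth_mxB oD' sP (smooth_mx_cst D' (sgn_mx R r s))).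
have oE : open [set M : 'M[R]_(r + s) | `|M| < sgn_radius R r s].
  have -> : [set M : 'M[R]_(r + s) | `|M| < sgn_radius R r s] =
      ball (0 : 'M[R]_(r + s)) (sgn_radius R r s).
    by rewrite -ball_normE; apply/seteqP; split=> M /=; rewrite sub0r normrN.
  apply: ball_open; by rewrite /sgn_radius invr_gt0 ltr0n.
have := open_preimage oD' (hP 0%N) oE.
congr open; apply/seteqP; split=> x.
  by move=> [[Dx Pu] Pd].
by move=> [Dx [Pu Pd]].
Qed.
End smoothness.
End schur.

(** * Coordinates on symmetric forms *)

Section symmetric_forms.
Context (R : realType) (m : nat).
Notation S2 := (sym_forms R m).

Definition to_sym (tau : 'M[R]_m) : S2 :=
  vsproj (fixedSpace (linfun (@trmx R m m))) tau.

Lemma sym_formT (tau : S2) : (vsval tau)^T = vsval tau.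
Proof. by have /fixedSpaceP := subvsP tau; rewrite lfunE. Qed.

Lemma to_symK tau : tau^T = tau -> vsval (to_sym tau) = tau.
Proof. by move=> st; apply/vsprojK/fixedSpaceP; rewrite lfunE. Qed.

Lemma vsval_symK : cancel vsval to_sym.
Proof. by move=> tau; apply: vsvalK. Qed.

Lemma to_sym_linear : linear to_sym.
Proof. by move=> a x y; rewrite /to_sym linearD linearZ. Qed.
End symmetric_forms.

Section coordinates.
Context (R : realType) (V : vectType R).

Definition vcoord (v : V) : 'rV[R]_(\dim {:V}) :=
  \row_j coord (vbasis fullv) j v.
Definition vuncoord (w : 'rV[R]_(\dim {:V})) : V :=
  \sum_j w 0 j *: (vbasis fullv)`_j.

Lemma coord_basis_surj (b : (\dim {:V}).-tuple V) (w : 'rV[R]_(\dim {:V})) :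
  basis_of fullv b -> exists v, \row_j coord b j v = w.
Proof.
move=> bb; exists (\sum_j w 0 j *: b`_j); apply/rowP => j.
by rewrite mxE coord_sum_free // (basis_free bb).
Qed.

Lemma vcoordK : cancel vcoord vuncoord.
Proof.
move=> v; rewrite [RHS](coord_vbasis (memvf v)).
by apply: eq_bigr => j _; rewrite mxE.
Qed.

Lemma vuncoordK : cancel vuncoord vcoord.
Proof.
move=> w; apply/rowP => j; rewrite mxE coord_sum_free //.
exact: (basis_free (vbasisP _)).
Qed.

Lemma vcoord_linear : linear vcoord.
Proof. by move=> a x y; apply/rowP => j; rewrite !mxE linearD linearZ. Qed.

Lemma vuncoord_linear : linear vuncoord.
Proof.
move=> a x y; rewrite /vuncoord scaler_sumr -big_split /=.
by apply: eq_bigr => j _; rewrite !mxE scalerDl scalerA.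
Qed.
End coordinates.

(** * The local model of the strata *)

Section local_model.
Context (R : realType) (n r s m : nat) (B : 'M[R]_n).
Context (e1 : 'M[R]_(r + s, n)) (e2 f1 : 'M[R]_(m, n)).
Context (f : 'M[R]_(n - (r + s + m), n)) (L : 'M[R]_(m, n - (r + s + m))).
Hypothesis (le_n : (r + s + m <= n)%N) (sB : B^T = B).
Hypothesis (H : hyperbolic_frame B e1 e2 f1 f L).
Hypothesis (e11 : e1 *m B *m e1^T = sgn_mx R r s).

Notation i := (r + s + m)%N.
Notation d := (i * (n - i))%N.
Notation S2 := (sym_forms R m).
Notation N := (\dim {:S2}).
Notation k := (d - N)%N.
Notation A := (Gr_atlas R i n).
Notation O := (orbit_rs i (bf B)).
Notation e := (col_mx e1 e2).
Notation sigma := (schur B e1 e2 f).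
Notation T := (lin_schur B e2 f).
Notation push := (@sym_push R n r s m L).
Notation Om := (regular B e1 f).
Notation psi0 := (shear B e1 e2 f L).
Notation psi0' := (unshear B e1 e2 f L).

Definition tangent (v : 'rV[R]_d) : 'rV[R]_N := vcoord (to_sym (T (vec_mx v))).

Lemma tangent_linear : linear tangent.
Proof.
move=> a x y; rewrite /tangent linearD linearZ /=.
by rewrite lin_schur_linear to_sym_linear vcoord_linear.
Qed.

(** [lin_schur] is onto the symmetric matrices because it sends [push tau] to
    tau; hence the codimension of its kernel is the dimension of the space of
    symmetric forms. *)
Lemma exists_slice_mx : exists2 G, G \in unitmx & forall X,
  T X = 0 <-> slice k (mxvec X *m G).
Proof.
pose tL : {linear 'rV[R]_d -> 'rV[R]_N} :=
  HB.pack tangent (GRing.isLinear.Build _ _ _ _ _ tangent_linear).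
have tE v : v *m lin1_mx tL = tangent v by rewrite mul_rV_lin1.
have full : row_full (lin1_mx tL).
  apply/row_fullP.
  exists (\matrix_j mxvec (push (vsval (vuncoord (delta_mx 0 j) : S2)))).
  apply/row_matrixP => j; rewrite row_mul rowK row1 tE /tangent mxvecK.
  have -> : T (push (vsval (vuncoord (delta_mx 0 j) : S2))) =
            vsval (vuncoord (delta_mx 0 j) : S2).
    rewrite -[push _]add0r (lin_schur_push sB H) ?sym_formT //.
    by rewrite lin_schur0 add0r.
  by rewrite vsval_symK vuncoordK.
have [G Gu hG] := exists_slice_coords full.
exists G => // X; rewrite -hG tE /tangent mxvecK.
have sT := lin_schur_sym B e2 f X.
split=> [->|h]; first by rewrite /to_sym linear0; apply/rowP => j; rewrite !mxE linear0.
rewrite -(to_symK sT) -[to_sym _]vcoordK h.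
by rewrite /vuncoord big1 ?linear0 // => j _; rewrite mxE scale0r.
Qed.

(** Some signature (a, c) of sigma X always exists, so that of W is
    (r + a, s + c); uniqueness of signatures gives the equivalence. *)
Lemma stratumP (W : Gr R i n) X r' s' : val W = rowspan (e + X *m f) -> Om X ->
  O r' s' W <-> [/\ (r <= r')%N, (s <= s')%N
    & has_signature (bf (sigma X)) (r' - r) (s' - s)].
Proof.
move=> WX OX; have [a [c h]] := exists_sig_split (schur_sym e1 e2 f sB X) fullv.
have hW := sig_split_signature (schur_sig le_n sB H OX h).
have hs := sig_split_signature h.
rewrite /orbit_rs /= WX; split=> [/(signature_uniq hW)[<- <-]|[rr ss]].
  by rewrite !leq_addr !addKn.
move=> /(signature_uniq hs)[ea ec].
by move: hW; rewrite ea ec !subnKC.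
Qed.

Lemma stratum0P (W : Gr R i n) X : val W = rowspan (e + X *m f) -> Om X ->
  O r s W <-> sigma X = 0.
Proof.
move=> WX OX; rewrite (stratumP r s WX OX) !subnn.
rewrite -(signature00 (schur_sym e1 e2 f sB X)).
by split=> [[]|].
Qed.

Section slice.
Context (G : 'M[R]_d) (Gu : G \in unitmx).
Hypothesis (hG : forall X, T X = 0 <-> slice k (mxvec X *m G)).
Context (x0 : Gr R i n) (x0E : val x0 = rowspan e).

Let psi X := mxvec (psi0 X) *m G.
Let psi' y := psi0' (vec_mx (y *m invmx G)).
Let Om' := [set y : 'rV[R]_d | Om (vec_mx (y *m invmx G))].
Let c := rechart e f Om psi.
Let U := cdom c.
Let S := U `&` O r s.
Let X_ (W : Gr R i n) := vec_mx (cmap (Gr_chart e f) W).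

Let psiOm X : Om X -> Om' (psi X).
Proof.
by move=> OX; rewrite /Om' /= /psi mulmxK // mxvecK; apply/regular_shear.
Qed.

Let psiOm' y : Om' y -> Om (psi' y).
Proof. by move=> Oy; apply/regular_unshear. Qed.

Let psiK X : Om X -> psi' (psi X) = X.
Proof. by move=> _; rewrite /psi' /psi mulmxK // mxvecK (shearK sB H). Qed.

Let psi'K y : Om' y -> psi (psi' y) = y.
Proof. by move=> _; rewrite /psi' /psi (unshearK sB H) vec_mxK mulmxKV. Qed.

Let spsi : smooth_fun Om psi.
Proof.
move=> V D F oD hO hF; apply: (smooth_mxM oD _ (smooth_mx_cst D _)).
by apply: (smooth_mxvec oD); apply: (smooth_shear _ _ oD hF).
Qed.

Let spsi' : smooth_fun Om' psi'.
Proof.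
move=> V D F oD hO hF; apply: (smooth_unshear _ _ oD _ hO).
by apply: (smooth_vec_mx oD); apply: (smooth_mxM oD hF (smooth_mx_cst D _)).
Qed.

Let oOm : open [set y | Om (vec_mx y)].
Proof.
have oT : open [set: 'rV[R]_d] by exact: openT.
have := open_regular B e1 f oT (smooth_vec_mx oT (smooth_mx_id oT)).
by congr open; apply/seteqP; split=> y //=; case.
Qed.

Let oOm' : open Om'.
Proof.
have oT : open [set: 'rV[R]_d] by exact: openT.
have sM := smooth_mxM oT (smooth_mx_id oT) (smooth_mx_cst setT (invmx G)).
have := open_regular B e1 f oT (smooth_vec_mx oT sM).
by congr open; apply/seteqP; split=> y //=; case.
Qed.

Let c_smooth : smooth_chart A c.
Proof.
exact: (rechart_smooth_chart le_n (hyp_full H) oOm oOm' psiOm psiOm' psiK psi'K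
  spsi spsi').
Qed.

Let oU : mopen A U.
Proof.
exact: (rechart_mopen le_n (hyp_full H) oOm oOm' psiOm psiOm' psiK psi'K
  spsi spsi').
Qed.

Let dual_ex : exists es fs, dual_frame e f es fs.
Proof. exact: exists_dual_frame le_n (hyp_full H). Qed.

Let XE W : U W -> val W = rowspan (e + X_ W *m f).
Proof. by have [es [fs dual]] := dual_ex; move=> [dW _]; apply: Gr_chartK dual _ dW. Qed.

Let graphU W X : val W = rowspan (e + X *m f) -> Om X -> U W /\ X_ W = X.
Proof.
have [es [fs dual]] := dual_ex; move=> /(Gr_chart_graph dual)[dW cW] OX.
have XW : X_ W = X by rewrite /X_ cW mxvecK.
by split=> //; split=> //; rewrite -/(X_ W) XW.
Qed.

Let x0U : U x0.
Proof.
have [] // := @graphU x0 0; first by rewrite mul0mx addr0.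
exact: regular0.
Qed.

(** In the chart c, which is the graph chart followed by the shear, the stratum is
    the zero set of sigma, and the shear turns sigma into a linear map. *)
Let slice_c W : U W -> O r s W <-> slice k (cmap c W).
Proof.
move=> UW; rewrite (stratum0P (XE UW)) -1?(lin_schur_shear sB H); last by case: UW.
exact: hG.
Qed.

Let c_slice Z : U `&` Z = U `&` O r s -> slice_chart A Z k c.
Proof.
move=> UZ; split=> //; rewrite -/U UZ; apply/seteqP; split.
  by move=> _ [W [UW OW] <-]; split; [exists W|apply/slice_c].
by move=> _ [[W UW <-] sW]; exists W => //; split=> //; apply/slice_c.
Qed.

Lemma local_slice_chart : exists2 c, slice_chart A (O r s) k c & cdom c x0.
Proof. by exists c; [apply: c_slice|]. Qed.

Hypothesis (x0O : O r s x0).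

Let gr X : Gr R i n := insubd x0 (rowspan (e + X *m f)).

Let grE X : val (gr X) = rowspan (e + X *m f).
Proof.
have [es [fs dual]] := dual_ex; rewrite val_insubd.
by rewrite (dim_rowspan (graph_row_free dual X)) eqxx.
Qed.

Let grX W : U W -> gr (X_ W) = W.
Proof. by move=> UW; apply: val_inj; rewrite grE [RHS]XE. Qed.

Let z0 : set_type S := SigSub (mem_set (conj x0U x0O) : x0 \in S).
Let toS (W : Gr R i n) : set_type S := insubd z0 W.

Let toSE W : S W -> set_val (toS W) = W.
Proof. by move=> SW; rewrite set_valE insubdK // inE. Qed.

Let zP (z : set_type S) : U (set_val z) /\ sigma (X_ (set_val z)) = 0.
Proof.
have [Uz Oz] : S (set_val z) by have := valP z; rewrite inE.
by split=> //; apply/(stratum0P (XE Uz)) => //; case: Uz.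
Qed.

(** The first component of [phi] moves W along [sym_push] until sigma
    vanishes; moving back by the second component recovers W. *)
Let phi (W : Gr R i n) : set_type S * S2 :=
  (toS (gr (X_ W - push (sigma (X_ W)))), to_sym (sigma (X_ W))).
Let phi' (z : set_type S * S2) : Gr R i n :=
  gr (X_ (set_val z.1) + push (vsval z.2)).

Let retract X : Om X -> Om (X - push (sigma X)) /\ sigma (X - push (sigma X)) = 0.
Proof.
move=> OX; rewrite -(sym_pushN L); split; first exact/regular_push.
by rewrite (schur_push sB H) ?subrr // linearN /= schur_sym.
Qed.

Let phi1 W : U W -> [/\ set_val (phi W).1 = gr (X_ W - push (sigma (X_ W))),
  U (gr (X_ W - push (sigma (X_ W)))) &
  X_ (set_val (phi W).1) = X_ W - push (sigma (X_ W))].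
Proof.
move=> [dW OW]; have [OY sY] := retract OW.
have [UY XY] := graphU (grE _) OY.
have e1' : set_val (phi W).1 = gr (X_ W - push (sigma (X_ W))).
  by apply: toSE; split=> //; apply/(stratum0P (grE _) OY).
by split=> //; rewrite e1'.
Qed.

Let phiK W : U W -> phi' (phi W) = W.
Proof.
move=> UW; have [_ _ XY] := phi1 UW.
by rewrite /phi' XY to_symK ?schur_sym // subrK grX.
Qed.

Let phi'P z : U (phi' z) /\ X_ (phi' z) = X_ (set_val z.1) + push (vsval z.2).
Proof.
have [[_ Oz] _] := zP z.1.
by apply: graphU; [exact: grE|apply/regular_push].
Qed.

Let phi'K z : phi (phi' z) = z.
Proof.
have [Uz sz] := zP z.1; have [UY XY] := phi'P z.
have sY : sigma (X_ (phi' z)) = vsval z.2.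
  by rewrite XY (schur_push sB H) ?sym_formT // sz add0r.
rewrite /phi sY XY addrK grX // vsval_symK; case: z {UY XY sY} Uz sz => z tau /= _ _.
congr pair; apply: val_inj; rewrite -!set_valE; apply: toSE.
by have := valP z; rewrite inE.
Qed.

Let kd : (k <= d)%N. Proof. exact: leq_subr. Qed.

(** A slice chart maps the submanifold onto the intersection of an open set with
    a slice, which is open in the first k coordinates. *)
Lemma prod_mopenT (Z : set (Gr R i n)) :
  mopen (prod_atlas (sub_atlas A Z k) (vect_atlas S2)) setT.
Proof.
move=> _ [_ [_ [[c1 [[c1i c1o _] c1s] <-] [b bb ->] ->]]].
have oT : open [set: 'rV[R]_(k + N)] by exact: openT.
have sl : smooth_mx setT (fun w : 'rV[R]_(k + N) =>
    lsubmx w *m (pid_mx k : 'M[R]_(k, d))).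
  apply: (smooth_mxM oT _ (smooth_mx_cst setT _)).
  apply: (smooth_linear (h := @lsubmx R 1 k N) oT _ (smooth_mx_id oT)) => a x y.
  by rewrite linearD linearZ.
have := open_preimage oT (smooth_mx_on oT sl 0%N) c1o.
congr open; apply/seteqP; split=> w.
  move=> [_ [W dW cW]].
  have [sw wK] := pid_slice kd (lsubmx w).
  have [W' [dW' ZW'] cW'] :
      (cmap c1 @` (cdom c1 `&` Z)) (lsubmx w *m (pid_mx k : 'M[R]_(k, d))).
    by rewrite c1s; split=> //; exists W.
  have [v vw] := coord_basis_surj (rsubmx w) bb.
  exists (SigSub (mem_set ZW' : W' \in Z), v) => //=.
  by rewrite vw set_valE /= cW' wK hsubmxK.
move=> [[z v] [[dz _] _] <-]; split=> //; exists (set_val z) => //.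
rewrite /= row_mxKl slice_pid //.
have : (cmap c1 @` (cdom c1 `&` Z)) (cmap c1 (set_val z)).
  by exists (set_val z) => //; split=> //; have := valP z; rewrite inE.
by rewrite c1s => -[].
Qed.

Lemma local_diffeo : diffeomorphism A
  (prod_atlas (sub_atlas A S k) (vect_atlas S2)) U setT phi.
Proof.
have cS : slice_chart A S k c by apply: c_slice; rewrite /S setIA setIid.
pose b := Chart setT (fun v : S2 => vcoord v).
pose c' := prod_chart (sub_chart S k c) b.
have Ac' : prod_atlas (sub_atlas A S k) (vect_atlas S2) c'.
  exists (sub_chart S k c), b; split=> //; first by exists c.
  by exists (vbasis fullv) => //; apply: vbasisP.
have Ac : A (Gr_chart e f) by exists e, f; split=> //; apply: hyp_full H.
have coordE (z : set_type S * S2) :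
    Om' (lsubmx (cmap c' z) *m (pid_mx k : 'M[R]_(k, d))) /\
    cmap (Gr_chart e f) (phi' z) =
    mxvec (psi' (lsubmx (cmap c' z) *m (pid_mx k : 'M[R]_(k, d))) +
           push (vsval (vuncoord (rsubmx (cmap c' z)) : S2))).
  have [_ Xz] := phi'P z; have [Uz sz] := zP z.1.
  have -> : lsubmx (cmap c' z) *m (pid_mx k : 'M[R]_(k, d)) = cmap c (set_val z.1).
    rewrite /c' /= row_mxKl slice_pid //; apply/(slice_c Uz)/(stratum0P (XE Uz)) => //.
    by case: Uz.
  have -> : vuncoord (rsubmx (cmap c' z)) = z.2 by rewrite /c' /= row_mxKr vcoordK.
  have OX : Om (X_ (set_val z.1)) by case: Uz.
  by split; [exact: psiOm|rewrite (psiK OX) -Xz vec_mxK].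
have oT : open [set: 'rV[R]_(k + N)] by exact: openT.
have slp : smooth_mx setT (fun w : 'rV[R]_(k + N) =>
    lsubmx w *m (pid_mx k : 'M[R]_(k, d))).
  apply: (smooth_mxM oT _ (smooth_mx_cst setT _)).
  apply: (smooth_linear (h := @lsubmx R 1 k N) oT _ (smooth_mx_id oT)) => a x y.
  by rewrite linearD linearZ.
have imU : cmap (Gr_chart e f) @` U `<=` [set y | Om (vec_mx y)].
  by move=> _ [W [_ OW] <-].
split.
- exact: oU.
- exact: prod_mopenT.
- split.
  + by move=> W _; exact: I.
  + by move=> W W' /set_mem UW /set_mem UW' h; rewrite -(phiK UW) h phiK.
  + by move=> z _; exists (phi' z); [have [] := phi'P z|exact: phi'K].
- move=> W UW; exists (Gr_chart e f), c', U; split.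
    by split; [exact: Ac|exact: Ac'|exact: oU].
  split; first exact: UW.
  + by move=> V UV; split; [exact: UV|case: UV].
  + move=> _ [V UV <-]; split; last exact: I.
    by have [eV UV' _] := phi1 UV; rewrite /= eV.
  exists (fun y => row_mx (psi (vec_mx y - push (sigma (vec_mx y))) *m pid_mx k)
                          (vcoord (to_sym (sigma (vec_mx y))))).
    move=> l; apply: Ck_on_sub imU _; move: l.
    have sX := smooth_vec_mx oOm (smooth_mx_id oOm).
    have ss := smooth_schur e2 oOm sX (fun y h => h).
    apply: (smooth_mx_on oOm); apply: (smooth_row_mx oOm).
      have sY := smooth_mxB oOm sX (smooth_linear oOm (sym_push_linear L) ss).
      have sp := spsi oOm (fun y Oy => (retract Oy).1) sY.
      exact: (smooth_mxM oOm sp (smooth_mx_cst _ (pid_mx k : 'M[R]_(d, k)))).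
    apply: (smooth_linear (h := fun tau => vcoord (to_sym tau)) oOm _ ss) => a x y.
    by rewrite to_sym_linear vcoord_linear.
  move=> V UV; have [eV UV' XV] := phi1 UV.
  by rewrite /= -/(X_ _) XV.
- exists phi'; first by move=> W; rewrite inE; apply: phiK.
  move=> z _; exists c', (Gr_chart e f), setT; split.
    by split; [exact: Ac'|exact: Ac|exact: prod_mopenT].
  split; first exact: I.
  + by move=> [w v] _; split; [exact: I|split; [have [] := zP w|exact: I]].
  + by move=> _ [w _ <-]; have [[]] := phi'P w.
  exists (fun y => mxvec (psi' (lsubmx y *m pid_mx k) +
                          push (vsval (vuncoord (rsubmx y) : S2)))).
    pose D := [set y : 'rV[R]_(k + N) | Om' (lsubmx y *m (pid_mx k : 'M[R]_(k, d)))].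
    have oD : open D.
      have := open_preimage oT (smooth_mx_on oT slp 0%N) oOm'.
      by congr open; apply/seteqP; split=> y //=; case.
    have sl : smooth_mx D (fun w : 'rV[R]_(k + N) =>
    lsubmx w *m (pid_mx k : 'M[R]_(k, d))).
      by move=> a b'; apply: smooth_on_sub (slp a b').
    have sr : smooth_mx D (fun w : 'rV[R]_(k + N) => vsval (vuncoord (rsubmx w) : S2)).
      apply: (smooth_linear (h := fun w => vsval (vuncoord (rsubmx w) : S2)) oD _
        (smooth_mx_id oD)).
      by move=> a x y; rewrite linearD linearZ vuncoord_linear linearD linearZ.
    have sp := spsi' oD (fun y h => h) sl.
    have sm := smooth_mxD oD sp (smooth_linear oD (sym_push_linear L) sr).
    apply: smooth_on_sub (smooth_mx_on oD (smooth_mxvec oD sm)).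
    by move=> _ [w _ <-]; have [] := coordE w.
  by move=> w _; have [_] := coordE w.
Qed.

Lemma local_normal_form : exists (U : set (Gr R i n))
    (V : set (set_type (U `&` O r s) * S2))
    (phi : Gr R i n -> set_type (U `&` O r s) * S2),
  [/\ mopen A U /\ U x0, (forall z : set_type (U `&` O r s), V (z, 0)),
    diffeomorphism A (prod_atlas (sub_atlas A (U `&` O r s) k) (vect_atlas S2))
      U V phi
  & forall y, U y -> forall r' s' : nat,
      O r' s' y <-> [/\ (r <= r')%N, (s <= s')%N
        & has_signature (bform (phi y).2) (r' - r) (s' - s)]].
Proof.
exists U, setT, phi; split.
- by split; [exact: oU|exact: x0U].
- by move=> z; exact: I.
- exact: local_diffeo.
move=> y Uy r' s'; have [_ Oy] := Uy.
have := stratumP r' s' (XE Uy) Oy.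
by rewrite -{1}(to_symK (schur_sym e1 e2 f sB (X_ y))).
Qed.
End slice.
End local_model.

(** * The theorem *)

Definition form_mx (R : realType) n (b : {symmetric 'rV[R]_n}) : 'M[R]_n :=
  \matrix_(i, j) b (delta_mx 0 i) (delta_mx 0 j).

Lemma form_mxE (R : realType) n (b : {symmetric 'rV[R]_n}) :
  (b : 'rV[R]_n -> 'rV[R]_n -> R) = bf (form_mx b).
Proof.
apply/funext => x; apply/funext => y.
rewrite {1}[x]row_sum_delta {1}[y]row_sum_delta linear_sumlz /bf mxE.
under eq_bigr do rewrite linear_sumr.
rewrite exchange_big /=; apply: eq_bigr => j _.
rewrite mxE mulr_suml; apply: eq_bigr => i _.
by rewrite linearZl_LR linearZ_LR /= !mxE -mulrA (mulrC (y 0 j)).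
Qed.

Lemma form_mx_sym (R : realType) n (b : {symmetric 'rV[R]_n}) :
  (form_mx b)^T = form_mx b.
Proof. by apply/matrixP => i j; rewrite !mxE hermC expr0 mul1r. Qed.

Lemma form_mx_unit (R : realType) n (b : {symmetric 'rV[R]_n}) :
  nondegenerate b -> form_mx b \in unitmx.
Proof.
move=> /eqP hb; rewrite -row_free_unit; apply/row_free_kerP => u ub.
apply/eqP; rewrite -memv0 -hb; apply/mem_orthovP => v _.
by rewrite form_mxE /bf ub mul0mx mxE.
Qed.

Lemma signature_bounds (R : realType) n (B : 'M[R]_n) W r s p q :
  signature_on (bf B) W r s -> has_signature (bf B) p q ->
  [/\ (r <= p)%N, (s <= q)%N & (r + s <= \dim W)%N].
Proof.
move=> [[[F [FW hF] <-] _] [[F' [F'W hF'] <-] _]] [[_ hp] [_ hq]]; split.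
- by apply: hp; split; first exact: subvf.
- by apply: hq; split; first exact: subvf.
apply: (posdef_nonpos_dim FW F'W hF) => x xF'.
have [->|x0] := eqVneq x 0; first by rewrite bf0l.
exact/ltW/hF'.
Qed.

Lemma exists_adapted_basis (R : realType) n (B : 'M[R]_n) r s m
    (x : Gr R (r + s + m) n) : B^T = B -> orbit_rs _ (bf B) r s x ->
  exists (e1 : 'M[R]_(r + s, n)) (e2 : 'M[R]_(m, n)),
    [/\ val x = rowspan (col_mx e1 e2), e1 *m B *m e1^T = sgn_mx R r s,
        e1 *m B *m e2^T = 0 & e2 *m B *m e2^T = 0].
Proof.
move=> sB Ox; have [r' [s' [m' [ep [en [e0 h]]]]]] := exists_sylvester sB (val x).
have [er es] := signature_uniq (sig_split_signature (sylvester_sig_split sB h)) Ox.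
subst r' s'; have em : m' = m.
  by have := syl_dim h; rewrite (eqP (valP x)); lia.
subst m'; exists (col_mx ep en), e0; split.
- by rewrite !rowspan_col (syl_span h).
- by rewrite gram_col (syl_pp h) (syl_nn h) (syl_pn h) (gram_tr0 sB (syl_pn h)).
- by rewrite 2!mul_col_mx (syl_p0 h) (syl_n0 h) col_mx0.
- exact: syl_00 h.
Qed.

(** The theorem for the form with Gram matrix B, with m independent of the
    expression i - r - s so that i can be replaced by r + s + m, the shape on
    which the block decompositions of the local model rely. *)
Lemma strata (R : realType) n r s m i (B : 'M[R]_n) :
  i = (r + s + m)%N -> (i <= n)%N -> B^T = B -> B \in unitmx ->
  let A := Gr_atlas R i n in
  let O := orbit_rs i (bf B) in
  let S2 := sym_forms R m in
  let k := (i * (n - i) - \dim {:S2})%N in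
  embedded_submanifold A (O r s) k /\
  forall x : Gr R i n, O r s x -> exists (U : set (Gr R i n))
      (V : set (set_type (U `&` O r s) * S2))
      (phi : Gr R i n -> set_type (U `&` O r s) * S2),
    [/\ mopen A U /\ U x, (forall z : set_type (U `&` O r s), V (z, 0)),
      diffeomorphism A (prod_atlas (sub_atlas A (U `&` O r s) k) (vect_atlas S2))
        U V phi
    & forall y, U y -> forall r' s' : nat,
        O r' s' y <-> [/\ (r <= r')%N, (s <= s')%N
          & has_signature (bform (phi y).2) (r' - r) (s' - s)]].
Proof.
move=> -> le_n sB Bu A O S2 k.
have local (x : Gr R (r + s + m) n) : O r s x ->
    exists (e1 : 'M[R]_(r + s, n)) (e2 f1 : 'M[R]_(m, n)) f L,
    [/\ val x = rowspan (col_mx e1 e2), hyperbolic_frame B e1 e2 f1 f L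
      & e1 *m B *m e1^T = sgn_mx R r s].
  move=> Ox; have [e1 [e2 [xE e11 e12 e22]]] := exists_adapted_basis sB Ox.
  have fe : row_free (col_mx e1 e2).
    by apply: dim_row_free; rewrite -xE; apply/eqP/(valP x).
  have e1u : e1 *m B *m e1^T \in unitmx by rewrite e11 sgn_mx_unit.
  have [f1 [f [L H]]] := exists_hyperbolic_frame le_n sB Bu e1u e12 e22 fe.
  by exists e1, e2, f1, f, L.
split; first split=> [|x Ox]; first exact: leq_subr.
  have [e1 [e2 [f1 [f [L [xE H e11]]]]]] := local x Ox.
  have [G Gu hG] := exists_slice_mx sB H.
  exact: (local_slice_chart le_n sB H e11 Gu hG xE).
move=> x Ox; have [e1 [e2 [f1 [f [L [xE H e11]]]]]] := local x Ox.
have [G Gu hG] := exists_slice_mx sB H.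
exact: (local_normal_form le_n sB H e11 Gu hG xE Ox).
Qed.

Theorem corollary3p6 (R : realType) (n p q i : nat)
  (b : {symmetric 'rV[R]_n})
  (hn : n = (p + q)%N) (hb : nondegenerate b) (hsig : has_signature b p q)
  (hi : (1 <= i <= n - 1)%N)
  (r s : nat) (hr : (r <= p)%N) (hs : (s <= q)%N) (hrs : (r + s <= i)%N) :
  let A := Gr_atlas R i n in
  let O := orbit_rs i b in
  let S2 := sym_forms R (i - r - s) in
  exists k : nat,
    embedded_submanifold A (O r s) k /\
    forall x : Gr R i n, O r s x ->
      exists (U : set (Gr R i n))
             (V : set (set_type (U `&` O r s) * S2))
             (phi : Gr R i n -> set_type (U `&` O r s) * S2),
        [/\ mopen A U /\ U x,
            (forall z : set_type (U `&` O r s), V (z, 0)),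
            diffeomorphism A
              (prod_atlas (sub_atlas A (U `&` O r s) k) (vect_atlas S2)) U V phi,
            U `<=` [set y | exists r' s',
              [/\ (r <= r' <= p)%N, (s <= s' <= q)%N, (r' + s' <= i)%N
                & O r' s' y]]
          & forall y, U y -> forall r' s' : nat,
              O r' s' y <-> [/\ (r <= r')%N, (s <= s')%N
                & has_signature (bform (phi y).2) (r' - r) (s' - s)]].
Proof.
have iE : i = (r + s + (i - r - s))%N by lia.
have le_n : (i <= n)%N by lia.
move: hsig; rewrite form_mxE => hsig A O S2.
have sB := form_mx_sym b.
have [emb loc] := strata iE le_n sB (form_mx_unit hb).
exists (i * (n - i) - \dim {:S2})%N; split=> // x Ox.
have [U [V [phi [oU V0 dphi hphi]]]] := loc x Ox.
exists U, V, phi; split=> // y Uy.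
have [r' [s' h]] := exists_sig_split sB (val y).
have sy := sig_split_signature h; exists r', s'.
have [rp sq rs] := signature_bounds sy hsig.
have [rr ss _] := (hphi y Uy r' s').1 sy.
by rewrite rr ss rp sq; split=> //; rewrite (eqP (valP y)) in rs.
Qed.
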